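(* Let $\mathcal C$ be the set of all pointed Schreier graphs $(\Gamma,q)$ obtained from the Schreier graph $\Gamma$ of the action of $F$ on the orbit of $\frac12$ (all dyadic rationals in $(0,1)$) by choosing an arbitrary vertex $q$ as base vertex. The closure $\overline{\mathcal C}$ of $\mathcal C$ in the space $\mathcal T$ of pointed marked graphs consists of the following three types of pointed graphs (up to isomorphism): A. the Schreier graph $\Gamma$ of dyadic rational numbers with any vertex as base vertex; B. the graphs $P(w)$ defined in the context, for arbitrary $w\in X^\omega$, with base vertex $a_{n-1}(g_0)$ for some $n\geq1$ (where $a_0(g_0):=g_0$; this base vertex has label $1^n0w$) or $b_n(g_0)$ for some $n\ge1$ (this base vertex has label $0^n1w$); C. the two graphs with vertex set $\mathbb Z$ (any vertex as base vertex): the one with edges $i\to i+1$ labeled $x_0$ and a loop labeled $x_1$ at every $i\in\mathbb Z$; and the one with both an edge $i\to i+1$ labeled $x_0$ and an edge $i\to i+1$ labeled $x_1$ for every $i\in\mathbb Z$.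
   Context: Thompson's group $F$ is the group of all strictly increasing piecewise linear homeomorphisms of $[0,1]$ that are differentiable except at finitely many dyadic rationals and whose slopes are integer powers of $2$; products are read left to right, $(fg)(x)=g(f(x))$, and $x^f:=f(x)$. It is generated by $x_0,x_1$, where $x_0(t)=t/2$ on $[0,\frac12]$, $t-\frac14$ on $[\frac12,\frac34]$, $2t-1$ on $[\frac34,1]$; and $x_1(t)=t$ on $[0,\frac12]$, $\frac t2+\frac14$ on $[\frac12,\frac34]$, $t-\frac18$ on $[\frac34,\frac78]$, $2t-1$ on $[\frac78,1]$. Schreier graph $\Gamma$ of the orbit of $\frac12$: the vertices are the points of the orbit, with a directed edge labeled $s\in\{x_0,x_1\}$ from $y$ to $z$ iff $y^s=z$. $\mathcal T$ is the space of isomorphism classes of connected pointed marked graphs: directed graphs with edges labeled by $x_0,x_1$ such that every vertex has exactly one outgoing and exactly one incoming edge of each label, with a selected base vertex; isomorphisms preserve orientation, labels and base vertex. The metric is $d((\Gamma_1,u),(\Gamma_2,v))=2^{-n}$, where $n$ is the largest integer such that the balls of radius $n$ around $u$ and $v$ are isomorphic as pointed marked graphs (and $d=0$ if the pointed graphs are isomorphic). Let $X=\{0,1\}$, let $X^*$ be the set of finite words ($\varnothing$ the empty word) and $X^\omega$ the set of infinite words. The graph $P(w)$ for $w=w_1w_2w_3\ldots\in X^\omega$. The grey vertices are: $g_k$ for $k\ge0$; $d_0(p)$ for $p\in X^*$, with the identification $d_0(\varnothing)=g_0$; and $d_k(p)$ for $k\ge1$ and $p\in X^*$. Each grey vertex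 has a left child and a right child: the left child of $d_k(p)$ is $d_k(1p)$ and its right child is $d_k(0p)$ for all $k\ge 0$, $p\in X^*$; for $k\ge1$, if $w_k=0$ then the right child of $g_k$ is $g_{k-1}$ and its left child is $d_k(\varnothing)$, while if $w_k=1$ then the left child of $g_k$ is $g_{k-1}$ and its right child is $d_k(\varnothing)$. In addition, each grey vertex $v$ has attached white vertices $a_i(v)$, $i\ge1$, and black vertices $b_i(v)$, $i\ge1$ (all these vertices are distinct). The edges, for every grey $v$ and every $i\ge1$, are: labeled $x_0$: $v\to b_1(v)$, $b_i(v)\to b_{i+1}(v)$, $a_1(v)\to v$, $a_{i+1}(v)\to a_i(v)$; labeled $x_1$: a loop at $b_i(v)$, $a_{i+1}(v)\to a_i(v)$, $a_1(v)\to$ (left child of $v$), $v\to$ (right child of $v$). The vertex $g_0$ has label $10w\in X^\omega$, and the labels of all other vertices are determined by following edges according to the standard action of $F$ on $X^\omega$: $x_0: 0u\mapsto 00u,\ 10u\mapsto 01u,\ 11u\mapsto 1u$; $x_1: 0u\mapsto 0u,\ 10u\mapsto 100u,\ 110u\mapsto 101u,\ 111u\mapsto 11u$. *)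

(* Defs.v *)
From HB Require Import structures.
From mathcomp Require Import all_boot all_order all_algebra.
From mathcomp Require Import all_classical all_reals all_analysis.

Set Implicit Arguments.
Unset Strict Implicit.
Unset Printing Implicit Defensive.

Import Order.TTheory GRing.Theory Num.Theory.
Import numFieldNormedType.Exports.

Local Open Scope classical_set_scope.
Local Open Scope ring_scope.

Inductive gen := X0 | X1.

Record ptgraph := PtGraph {
  vert :> Type;
  edge : gen -> vert -> vert -> Prop;
  base : vert }.

Arguments edge {p} : rename.
Arguments base {p} : rename.

Definition marked (G : ptgraph) : Prop :=
  (forall s (u : G), exists! v, edge s u v) /\
  (forall s (v : G), exists! u, edge s u v).

Definition adj (G : ptgraph) (u v : G) : Prop :=
  exists s, edge s u v \/ edge s v u.

(* The distance from [u] to [v], ignoring orientations, is at most [n]. *)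
Fixpoint near (G : ptgraph) (n : nat) (u v : G) : Prop :=
  if n is m.+1 then near m u v \/ exists2 v', near m u v' & adj v' v
  else u = v.

Definition connected (G : ptgraph) : Prop :=
  forall u v : G, exists n, near n u v.

Definition iso (G H : ptgraph) : Prop :=
  exists f : G -> H, [/\ bijective f, f base = base &
    forall s u v, edge s u v <-> edge s (f u) (f v)].

Lemma near_refl (G : ptgraph) n (u : G) : near n u u.
Proof. by elim: n => //= n IHn; left. Qed.

Lemma near_mono (G : ptgraph) m n (u v : G) :
  (m <= n)%N -> near m u v -> near n u v.
Proof.
elim: n => [|n IHn]; first by rewrite leqn0 => /eqP ->.
by rewrite leq_eqVlt => /predU1P[->//|]; rewrite ltnS => /IHn {}IHn /IHn; left.
Qed.

(* The subgraph induced on the vertices at distance at most [n] of the base. *)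
Definition gball (n : nat) (G : ptgraph) : ptgraph :=
  @PtGraph {v : G | near n base v}
    (fun s u v => edge s (sval u) (sval v))
    (exist _ base (near_refl n base)).

Definition agree (n : nat) (G H : ptgraph) : Prop := iso (gball n G) (gball n H).

(* Balls agreeing at radius [n] agree at all smaller radii, so that the infimum
   below is [2 ^- n] for the largest [n] such that the balls of radius [n] are
   isomorphic.  Already the balls of radius 0 may differ, by their loops; this
   case is treated as [n = -1], hence the value [2]. *)
Definition gdist (R : realType) (G H : ptgraph) : R :=
  if `[< iso G H >] then 0
  else inf ([set 2] `|` [set 2 ^- n | n in [set n | agree n G H]]).

Lemma iso_refl G : iso G G.
Proof. by exists id; split => //; exists id. Qed.

Lemma iso_sym G H : iso G H -> iso H G.
Proof.
move=> [f [[g fK gK] fb fe]]; exists g; split; first by exists f.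
  by rewrite -fb fK.
by move=> s u v; rewrite fe !gK.
Qed.

Lemma iso_trans G H K : iso G H -> iso H K -> iso G K.
Proof.
move=> [f [fB fb fe]] [g [gB gb ge]]; exists (g \o f); split.
- exact: bij_comp.
- by rewrite /= fb gb.
- by move=> s u v; rewrite fe ge.
Qed.

Lemma sval_inj_gball n G (u v : gball n G) : sval u = sval v -> u = v.
Proof. by case: u v => [u pu] [v pv] /= uv; exact: eq_exist. Qed.

Lemma near_gball n k G H (f : gball n G -> gball n H) :
  f base = base -> (forall s u v, edge s u v -> edge s (f u) (f v)) ->
  (k <= n)%N -> forall u : gball n G,
  near k base (sval u) -> near k base (sval (f u)).
Proof.
move=> fb fe; elim: k => [_ u /= ub|k IHk kn u /= [ku|[v kv [s vu]]]].
- by rewrite (_ : u = base) ?fb//; exact: sval_inj_gball.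
- by left; apply: IHk => //; exact: ltnW.
- right; have nv : near n base v by apply: near_mono kv; exact: ltnW.
  exists (sval (f (exist _ v nv))); first by apply: IHk => //; exact: ltnW.
  exists s; case: vu => vu; [left|right].
    exact: (fe s (exist _ v nv) u).
  exact: (fe s u (exist _ v nv)).
Qed.

Lemma agree_mono m n G H : (m <= n)%N -> agree n G H -> agree m G H.
Proof.
move=> mn [f [[g fK gK] fb fe]].
have gb : g base = base by rewrite -fb fK.
have ge s u v : edge s u v -> edge s (g u) (g v) by rewrite fe !gK.
have fe' s u v : edge s u v -> edge s (f u) (f v) by rewrite fe.
pose up (K : ptgraph) (u : gball m K) : gball n K :=
  exist _ (sval u) (near_mono mn (svalP u)).
pose F (u : gball m G) : gball m H :=
  exist _ (sval (f (up _ u))) (near_gball fb fe' mn (u := up _ u) (svalP u)).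
pose F' (u : gball m H) : gball m G :=
  exist _ (sval (g (up _ u))) (near_gball gb ge mn (u := up _ u) (svalP u)).
exists F; split.
- exists F' => u; apply: sval_inj_gball => /=.
    by rewrite (_ : up H (F u) = f (up G u)) ?fK//; exact: sval_inj_gball.
  by rewrite (_ : up G (F' u) = g (up H u)) ?gK//; exact: sval_inj_gball.
- apply: sval_inj_gball => /=.
  by rewrite (_ : up G _ = @base (gball n G)) ?fb//; exact: sval_inj_gball.
- by move=> s u v; exact: (fe s (up _ u) (up _ v)).
Qed.

Lemma iso_agree n G H : iso G H -> agree n G H.
Proof.
move=> [f [[g fK gK] fb fe]].
have nearP k (K L : ptgraph) (h : K -> L) :
    (forall s u v, edge s u v -> edge s (h u) (h v)) ->
    forall u v, near k u v -> near k (h u) (h v).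
  move=> he; elim: k => [u v ->//|k IHk u v /= [/IHk|]]; first by left.
  move=> [v' /IHk uv' [s vv']]; right; exists (h v') => //; exists s.
  by case: vv' => /he; [left|right].
have fn (u : gball n G) : near n base (f (sval u)).
  by rewrite -fb; apply: nearP (svalP u) => s x y /fe.
have gn (u : gball n H) : near n base (g (sval u)).
  rewrite -[base]fK fb; apply: nearP (svalP u) => s x y.
  by rewrite fe !gK.
exists (fun u => exist _ (f (sval u)) (fn u)); split.
- by exists (fun u => exist _ (g (sval u)) (gn u)) => u;
    apply: sval_inj_gball; rewrite /= ?fK ?gK.
- exact: sval_inj_gball.
- by move=> s u v; exact: fe.
Qed.

(* Labeled walks are deterministic, so isomorphisms of balls are unique and
   those of all radii glue together. *)
Lemma agree_iso G H : marked G -> marked H -> connected G -> connected H ->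
  (forall n, agree n G H) -> iso G H.
Proof.
move=> [Gout Gin] [Hout Hin] Gc Hc agr; pose f n := sval (cid (agr n)).
have fP n : [/\ bijective (f n), f n base = base & forall s u v,
    edge s u v <-> edge s (f n u) (f n v)] := svalP (cid (agr n)).
have funiq k : forall n m (u : G) (nu : near n base u) (mu : near m base u),
    (k <= n)%N -> (k <= m)%N -> near k base u ->
    sval (f n (exist _ u nu)) = sval (f m (exist _ u mu)).
  elim: k => [|k IHk] n m u nu mu kn km /=.
    move=> ub; case: (fP n) (fP m) => [_ fn _] [_ fm _].
    rewrite (_ : exist _ u nu = @base (gball n G)) ?fn; last exact: sval_inj_gball.
    by rewrite (_ : exist _ u mu = @base (gball m G)) ?fm; last exact: sval_inj_gball.
  case=> [ku|[v kv [s vu]]]; first by apply: IHk => //; exact: ltnW.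
  have nv : near n base v by apply: near_mono kv; exact: ltnW.
  have mv : near m base v by apply: near_mono kv; exact: ltnW.
  have fv := IHk n m v nv mv (ltnW kn) (ltnW km) kv.
  case: (fP n) (fP m) => [_ _ fne] [_ _ fme].
  case: vu => vu.
  - have := (fne s (exist _ v nv) (exist _ u nu)).1 vu.
    have := (fme s (exist _ v mv) (exist _ u mu)).1 vu.
    rewrite /= fv => e1 e2.
    have [y [_ yu]] := Hout s (sval (f m (exist _ v mv))).
    by rewrite -(yu _ e1) -(yu _ e2).
  - have := (fne s (exist _ u nu) (exist _ v nv)).1 vu.
    have := (fme s (exist _ u mu) (exist _ v mv)).1 vu.
    rewrite /= fv => e1 e2.
    have [y [_ yu]] := Hin s (sval (f m (exist _ v mv))).
    by rewrite -(yu _ e1) -(yu _ e2).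
pose r u := sval (cid (Gc base u)); have rP u : near (r u) base u := svalP (cid (Gc base u)).
pose F u := sval (f (r u) (exist _ u (rP u))).
have FE n u (nu : near n base u) : F u = sval (f n (exist _ u nu)).
  have [run|nru] := leqP (r u) n.
    by apply: (funiq (r u)) => //.
  by apply: (funiq n) => //; exact: ltnW.
exists F; split.
- rewrite -setTT_bijective; split => //.
  + move=> u v _ _ Fuv; pose n := maxn (r u) (r v).
    have nu : near n base u by apply: near_mono (rP u); exact: leq_maxl.
    have nv : near n base v by apply: near_mono (rP v); exact: leq_maxr.
    move: Fuv; rewrite (FE n u nu) (FE n v nv).
    case: (fP n) => [/bij_inj fI _ _].
    by move=> /sval_inj_gball/fI/(congr1 sval).
  + move=> v _; have [n nv] := Hc base v.
    case: (fP n) => [[g _ gK] _ _].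
    case gv : (g (exist _ v nv)) => [u nu].
    by exists u => //; rewrite (FE n u nu) -gv gK.
- rewrite (FE 0%N base erefl); case: (fP 0%N) => [_ f0 _].
  by rewrite (_ : exist _ base _ = @base (gball 0 G)) ?f0//; exact: sval_inj_gball.
- move=> s u v; pose n := maxn (r u) (r v).
  have nu : near n base u by apply: near_mono (rP u); exact: leq_maxl.
  have nv : near n base v by apply: near_mono (rP v); exact: leq_maxr.
  rewrite (FE n u nu) (FE n v nv); case: (fP n) => [_ _ fe].
  exact: (fe s (exist _ u nu) (exist _ v nv)).
Qed.

Section gdist_theory.
Context {R : realType}.
Implicit Types G H K : ptgraph.

Let dset G H : set R := [set 2] `|` [set 2 ^- n | n in [set n | agree n G H]].

Let dset_ge0 G H : lbound (dset G H) 0.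
Proof. by move=> _ [->|[n _ <-]] //; rewrite invr_ge0 exprn_ge0. Qed.

Let dset_inf G H : has_inf (dset G H).
Proof. by split; [exists 2; left|exists 0; exact: dset_ge0]. Qed.

Lemma gdist_ge0 G H : 0 <= gdist R G H.
Proof.
rewrite /gdist; case: asboolP => // _.
by apply: lb_le_inf; [case: (dset_inf G H)|exact: dset_ge0].
Qed.

Lemma gdist_le G H G' H' : (iso G' H' -> iso G H) ->
  (forall n, agree n G' H' -> agree n G H) -> gdist R G H <= gdist R G' H'.
Proof.
move=> ii ag; have := gdist_ge0 G' H'.
rewrite /gdist; case: asboolP => [/ii i|_]; first by rewrite asboolT.
case: asboolP => // _ _.
apply: lb_le_inf; first by case: (dset_inf G' H').
move=> y y'; apply: ge_inf; first by case: (dset_inf G H).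
by case: y' => [->|[n /ag nGH <-]]; [left|right; exists n].
Qed.

Lemma gdist_gt0 G H n : ~ agree n G H -> 0 < gdist R G H.
Proof.
move=> nGH; rewrite /gdist; case: asboolP => [/(@iso_agree n)//|_].
apply: (@lt_le_trans _ _ (2 ^- n)); first by rewrite invr_gt0 exprn_gt0.
apply: lb_le_inf; first by case: (dset_inf G H).
have le1 k : 2 ^- k <= 1 :> R by rewrite invf_le1 ?exprn_gt0// exprn_ege1// ler1n.
move=> _ [->|[m mGH <-]]; first by rewrite (le_trans (le1 n))// ler1n.
rewrite lef_pV2 ?posrE ?exprn_gt0// ler_weXn2l ?ler1n//.
by rewrite leqNgt; apply/negP => /ltnW/agree_mono/(_ mGH).
Qed.

End gdist_theory.

Definition iso_class (G : ptgraph) : set ptgraph := [set H | iso G H].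

(* The points are the isomorphism classes of connected marked graphs.  [R] is
   only the field in which the distance takes its values. *)
Record graph_space (R : realType) := GraphSpace {
  carrier :> set ptgraph;
  carrierP : exists2 G, marked G /\ connected G & carrier = iso_class G }.

Definition repr_graph (R : realType) (x : graph_space R) : ptgraph :=
  sval (cid2 (carrierP x)).

Section graph_space_metric.
Context {R : realType}.
Implicit Types x y z : graph_space R.

HB.instance Definition _ := gen_eqMixin (graph_space R).
HB.instance Definition _ := gen_choiceMixin (graph_space R).

Definition class_dist x y : R := gdist R (repr_graph x) (repr_graph y).

Let reprP x : (marked (repr_graph x) /\ connected (repr_graph x)) /\
  carrier x = iso_class (repr_graph x).
Proof. by rewrite /repr_graph; case: cid2. Qed.

Let isoP x y : (forall n, agree n (repr_graph x) (repr_graph y)) ->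
  iso (repr_graph x) (repr_graph y).
Proof.
by case: (reprP x) (reprP y) => -[mx cx] _ [[my cy] _]; exact: agree_iso.
Qed.

Lemma class_distxx x : class_dist x x = 0.
Proof. by rewrite /class_dist /gdist asboolT//; exact: iso_refl. Qed.

Lemma class_dist_eq0 x y : class_dist x y = 0 -> x = y.
Proof.
move=> d0; have xy : iso (repr_graph x) (repr_graph y).
  apply: isoP => n; apply: contrapT => /(@gdist_gt0 R).
  by rewrite -/(class_dist x y) d0 ltxx.
have {xy} : carrier x = carrier y.
  rewrite (reprP x).2 (reprP y).2; apply/seteqP; split => K /=.
    exact: iso_trans (iso_sym xy).
  exact: iso_trans xy.
by case: x y {d0} => [c cP] [c' c'P] /= cc'; subst c'; congr GraphSpace.
Qed.

Lemma class_distC x y : class_dist x y = class_dist y x.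
Proof.
by apply/eqP; rewrite eq_le; apply/andP; split; apply: gdist_le => [|n];
  exact: iso_sym.
Qed.

Lemma class_dist_triangle y x z :
  class_dist x z <= class_dist x y + class_dist y z.
Proof.
have tr n : agree n (repr_graph x) (repr_graph y) ->
    agree n (repr_graph y) (repr_graph z) ->
    agree n (repr_graph x) (repr_graph z) by exact: iso_trans.
have [yx|/existsNP[n /not_implyP[nyz nxy]]] :=
    pselect (forall n, agree n (repr_graph y) (repr_graph z) ->
                       agree n (repr_graph x) (repr_graph y)).
  apply: ler_wpDl; first exact: gdist_ge0.
  have yz n : agree n (repr_graph y) (repr_graph z) ->
              agree n (repr_graph x) (repr_graph z).
    by move=> nyz; apply: tr => //; exact: yx.
  by apply: gdist_le => // iyz; apply: isoP => n; apply/yz/iso_agree.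
apply: ler_wpDr; first exact: gdist_ge0.
have xz m : agree m (repr_graph x) (repr_graph y) ->
            agree m (repr_graph x) (repr_graph z).
  move=> mxy; apply: tr => //; apply: agree_mono nyz.
  by rewrite leqNgt; apply/negP => /ltnW/agree_mono/(_ mxy).
by apply: gdist_le => // ixy; apply: isoP => m; apply/xz/iso_agree.
Qed.

HB.instance Definition _ := @isMetric.Build R (graph_space R) class_dist
  class_distxx class_dist_eq0 class_distC class_dist_triangle.

End graph_space_metric.

Section thompson.
Context {R : realType}.

Definition dyadic : set R :=
  [set x | exists (m : int) (n : nat), x = m%:~R / 2 ^+ n].

(* [t] lists the right ends of the successive pieces of [0,1]. *)
Definition piecewise_linear2 (f : R -> R) : Prop :=
  exists t : seq R, [/\ path <%R 0 t, last 0 t = 1 &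
    forall i, (i < size t)%N -> exists (k : int) (c : R),
      {in `[nth 0 (0 :: t) i, nth 0 t i], forall x, f x = 2 ^ k * x + c}].

(* Only the restriction of [f] to [0,1] matters.  The inverse of a continuous
   increasing bijection of [0,1] is continuous. *)
Definition thompsonF : set (R -> R) := [set f : R -> R |
  [/\ {in `[0, 1] &, {homo f : x y / x < y}},
      set_bij `[0, 1] `[0, 1] f,
      {within `[0 : R, 1], continuous f},
      piecewise_linear2 f &
      exists2 D : seq R, {in D, forall x, dyadic x} &
        {in `]0, 1[, forall x, x \notin D -> derivable f x 1}]].

Definition x0_map (t : R) : R :=
  if t <= 1 / 2 then t / 2 else if t <= 3 / 4 then t - 1 / 4 else 2 * t - 1.

Definition x1_map (t : R) : R :=
  if t <= 1 / 2 then t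
  else if t <= 3 / 4 then t / 2 + 1 / 4
  else if t <= 7 / 8 then t - 1 / 8 else 2 * t - 1.

Definition orbit_half : set R := [set f (1 / 2) | f in thompsonF].

Definition schreier (q : {x : R | orbit_half x}) : ptgraph :=
  @PtGraph {x : R | orbit_half x}
    (fun s y z => (if s is X0 then x0_map else x1_map) (sval y) = sval z) q.

End thompson.

(* Infinite words over {0,1}, with 1 encoded by [true]; the letter w_i of the
   1-indexed word w is [w i.-1]. *)
Definition word := nat -> bool.

Definition wcat (p : seq bool) (u : word) : word :=
  fun i => if (i < size p)%N then nth false p i else u (i - size p)%N.

(* [Dgrey k p] is d_k(p) and [Spine k] is g_{k+1}: the vertex g_0 is [Dgrey 0 [::]]. *)
Inductive grey := Dgrey of nat & seq bool | Spine of nat.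

Definition gvert (k : nat) : grey := if k is j.+1 then Spine j else Dgrey 0 [::].

(* Left children are [child w true], right children [child w false]; thus
   g_{k+1} has g_k as its right child exactly when w_{k+1} = 0. *)
Definition child (w : word) (x : bool) (v : grey) : grey :=
  match v with
  | Dgrey k p => Dgrey k (x :: p)
  | Spine k => if x == w k then gvert k else Dgrey k.+1 [::]
  end.

(* [White v i] is a_{i+1}(v) and [Black v i] is b_{i+1}(v). *)
Inductive pvert := Grey of grey | White of grey & nat | Black of grey & nat.

Definition avert (n : nat) (v : grey) : pvert :=
  if n is i.+1 then White v i else Grey v.

(* Only meaningful for [1 <= n]. *)
Definition bvert (n : nat) (v : grey) : pvert := Black v n.-1.

Inductive pedge (w : word) : gen -> pvert -> pvert -> Prop :=
| pedge0_grey v : pedge w X0 (Grey v) (bvert 1 v)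
| pedge0_black v i : (1 <= i)%N -> pedge w X0 (bvert i v) (bvert i.+1 v)
| pedge0_white1 v : pedge w X0 (avert 1 v) (Grey v)
| pedge0_white v i : (1 <= i)%N -> pedge w X0 (avert i.+1 v) (avert i v)
| pedge1_black v i : (1 <= i)%N -> pedge w X1 (bvert i v) (bvert i v)
| pedge1_white v i : (1 <= i)%N -> pedge w X1 (avert i.+1 v) (avert i v)
| pedge1_white1 v : pedge w X1 (avert 1 v) (Grey (child w true v))
| pedge1_grey v : pedge w X1 (Grey v) (Grey (child w false v)).

Definition Pgraph (w : word) (u : pvert) : ptgraph := PtGraph (pedge w) u.

Inductive word_step : gen -> word -> word -> Prop :=
| x0_0 u : word_step X0 (wcat [:: false] u) (wcat [:: false; false] u)
| x0_10 u : word_step X0 (wcat [:: true; false] u) (wcat [:: false; true] u)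
| x0_11 u : word_step X0 (wcat [:: true; true] u) (wcat [:: true] u)
| x1_0 u : word_step X1 (wcat [:: false] u) (wcat [:: false] u)
| x1_10 u : word_step X1 (wcat [:: true; false] u)
                         (wcat [:: true; false; false] u)
| x1_110 u : word_step X1 (wcat [:: true; true; false] u)
                          (wcat [:: true; false; true] u)
| x1_111 u : word_step X1 (wcat [:: true; true; true] u)
                          (wcat [:: true; true] u).

Definition labeling (w : word) (lab : pvert -> word) : Prop :=
  lab (Grey (gvert 0)) = wcat [:: true; false] w /\
  forall s u v, pedge w s u v -> word_step s (lab u) (lab v).

Definition line_loops (i : int) : ptgraph :=
  PtGraph (fun s (j k : int) => if s is X0 then k = j + 1 else k = j) i.

Definition line_double (i : int) : ptgraph :=
  PtGraph (fun (_ : gen) (j k : int) => k = j + 1) i.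

(* Main.v *)
Require Import Defs.
From mathcomp Require Import all_boot all_order all_algebra.
From mathcomp Require Import all_classical all_reals all_analysis.
From mathcomp Require Import zify ring lra.

(** The orbit of [1/2]. Along an element of F the constant terms of the linear
    pieces stay dyadic, so the image of [1/2] is dyadic ([thompson_dyadic]);
    conversely a dyadic number is reached by gluing linear pieces with slopes
    that are powers of 2 ([plmap_multiple]).

    The Schreier graph is a tree of grey vertices, the points [1/2 + y/4] with [y]
    in [[0, 1)], whose children prepend a binary digit to [y], with a white and a
    black ray attached to each grey vertex. Only the root [1/2] is special: it is
    its own right child. The graphs P(w) have the same local structure, but the
    ancestors of [g_0] form an infinite spine.

    These graphs are limits. A map that respects labels and is injective on a
    slightly larger ball identifies balls ([agree_local]). If [w] is replaced far out
    by the digit 1 followed by zeros, labels become binary expansions and map P(w)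
    to the Schreier graph; grey vertices with the same label would have ancestors
    on the spine with the same label, but there the denominators all differ
    ([P_approx]). Far out on a black or white ray only a line is visible.

    There are no other limits. In a marked graph every vertex is reached from the
    base by a word, and agreement of balls preserves equations between short words
    ([agree_act]). Hence a limit [G] inherits every local property of the Schreier
    graph, and each of these is a computation with the maps [x_0] and [x_1] on
    [(0, 1)] ([limit_at]). If some vertex of [G] looks like the root, the
    approximating base points are eventually the same and [G] is a Schreier graph
    ([rootlike_schreier]). If [G] has no grey vertex, it is a single orbit of [x_0]
    of one colour, hence one of the two lines ([limit_line]). Otherwise every vertex
    lies on the [x_0]-orbit of a grey vertex, every grey vertex has a grey parent,
    and the word [w] of the letters met on the way up defines an isomorphism from
    P(w), for which it only remains to see that no grey vertex is its own ancestor: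
    in the Schreier graph denominators grow from a parent to its child
    ([limit_P]).

    Labels propagate along edges in both directions, because the two generators act
    by bijections on infinite words; as P(w) is connected, one label determines
    all ([labeling_unique]). *)

Set Implicit Arguments.
Unset Strict Implicit.
Unset Printing Implicit Defensive.

Import Order.TTheory GRing.Theory Num.Theory.
Import numFieldNormedType.Exports.

Local Open Scope classical_set_scope.
Local Open Scope ring_scope.

Local Notation near := Defs.near.
Local Notation connected := Defs.connected.

(** * Connectivity, moves and local agreement in marked graphs *)

Section connectivity.
Variable G : ptgraph.
Implicit Types u v w : G.

Definition conn u v := exists n, near n u v.

Lemma conn_refl u : conn u u.
Proof. by exists 0%N. Qed.

Lemma conn_trans u v w : conn u v -> conn v w -> conn u w.
Proof.
move=> [m uv] [n]; elim: n w => [w <-|n IHn w /= [/IHn//|]]; first by exists m.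
by move=> [v' /IHn[k uv'] v'w]; exists k.+1 => /=; right; exists v'.
Qed.

Lemma conn_edge s u v : edge s u v -> conn u v.
Proof.
by move=> uv; exists 1%N => /=; right; exists u => //; exists s; left.
Qed.

Lemma conn_edgeV s u v : edge s u v -> conn v u.
Proof.
by move=> uv; exists 1%N => /=; right; exists v => //; exists s; right.
Qed.

Lemma conn_sym u v : conn u v -> conn v u.
Proof.
move=> [n]; elim: n v => [v ->|n IHn v /= [/IHn//|]]; first by exists 0%N.
move=> [v' /IHn v'u [s [|] e]]; apply: conn_trans v'u.
  exact: conn_edgeV e.
exact: conn_edge e.
Qed.

Lemma connected_hub c : (forall u, conn u c) -> connected G.
Proof. by move=> hub u v; apply: conn_trans (hub u) _; exact: conn_sym. Qed.

Lemma conn_closed (P : G -> Prop) u v :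
  (forall x y, adj x y -> P x -> P y) -> conn u v -> P u -> P v.
Proof.
move=> Pad [n]; elim: n v => [v -> //|n IHn v /= [/IHn//|]].
by move=> [v' /IHn Pv' v'v] /Pv'; exact: Pad.
Qed.

End connectivity.

Section moves.
Variables (G : ptgraph) (mG : marked G).
Implicit Types (u v : G) (s : gen) (l : gen * bool) (a b : seq (gen * bool)).

Definition out s u : G := sval (cid (mG.1 s u)).
Definition inn s u : G := sval (cid (mG.2 s u)).

Lemma out_edge s u : edge s u (out s u).
Proof. by rewrite /out; case: cid => v /= []. Qed.

Lemma inn_edge s u : edge s (inn s u) u.
Proof. by rewrite /inn; case: cid => v /= []. Qed.

Lemma edge_out s u v : edge s u v <-> v = out s u.
Proof.
split => [uv|->]; last exact: out_edge.
have [w [_ wP]] := mG.1 s u.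
by rewrite -(wP _ uv) -(wP _ (out_edge s u)).
Qed.

Lemma edge_inn s u v : edge s u v <-> u = inn s v.
Proof.
split => [uv|->]; last exact: inn_edge.
have [w [_ wP]] := mG.2 s v.
by rewrite -(wP _ uv) -(wP _ (inn_edge s v)).
Qed.

Lemma outK s : cancel (out s) (inn s).
Proof. by move=> u; apply/esym/edge_inn/out_edge. Qed.

Lemma innK s : cancel (inn s) (out s).
Proof. by move=> u; apply/esym/edge_out/inn_edge. Qed.

(** A letter [(s, true)] follows the edge labeled [s] forwards, [(s, false)]
    backwards; the last letter of a word acts first. *)
Definition move l u := if l.2 then out l.1 u else inn l.1 u.
Definition act a u := foldr move u a.

Lemma act_cat a b u : act (a ++ b) u = act a (act b u).
Proof. exact: foldr_cat. Qed.

Lemma act_near a u : near (size a) u (act a u).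
Proof.
elim: a => //= -[s d] a IHa; right; exists (act a u) => //; exists s.
by case: d; [left; exact: out_edge|right; exact: inn_edge].
Qed.

Lemma near_act n u v : near n u v -> exists a, v = act a u.
Proof.
elim: n v => [v <-|n IHn v /= [/IHn//|]]; first by exists [::].
move=> [v' /IHn[a ->] [s [/edge_out->|/edge_inn->]]].
  by exists ((s, true) :: a).
by exists ((s, false) :: a).
Qed.

End moves.

Section agreement.
Implicit Types G H : ptgraph.

(** A label-preserving map that is injective one step beyond the radius reflects
    edges as well: an edge of the image lifts at its source, and injectivity
    identifies the end of the lift. *)
Lemma agree_local G H n (f : G -> H) : marked G -> marked H -> f base = base ->
  (forall s u v, near n.+1 base u -> near n.+1 base v ->
    edge s u v -> edge s (f u) (f v)) ->
  (forall u v, near n.+1 base u -> near n.+1 base v -> f u = f v -> u = v) ->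
  agree n G H.
Proof.
move=> mG mH fb fe fI.
have up k (u : G) : (k <= n)%N -> near k base u -> near n.+1 base u.
  by move=> kn; apply: near_mono; exact: leq_trans kn _.
have fnear k : (k <= n)%N -> forall u, near k base u -> near k base (f u).
  elim: k => [_ u <-//|k IHk kn u /= [ku|[v kv [s vu]]]].
    by left; apply: IHk => //; exact: ltnW.
  have nu : near n.+1 base u.
    by apply: (up k.+1) => //; right; exists v => //; exists s.
  have nv : near n.+1 base v by apply: (up k) => //; exact: ltnW.
  right; exists (f v); first by apply: IHk => //; exact: ltnW.
  by exists s; case: vu => /fe e; [left|right]; exact: e.
(* Walks in [H] lift to [G] edge by edge, so that [f] is onto the ball. *)
have lift k : (k <= n)%N -> forall y, near k base y ->
    exists2 u, near k base u & f u = y.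
  elim: k => [_ y <-|k IHk kn y /= [ky|[z kz [s zy]]]].
  - by exists base.
  - by have [u ku <-] := IHk (ltnW kn) _ ky; exists u => //; left.
  have [v kv vz] := IHk (ltnW kn) _ kz.
  have nv := up _ _ (ltnW kn) kv.
  case: zy => [/(edge_out mH)->|/(edge_inn mH)->].
  - have kw : near k.+1 base (out mG s v).
      by right; exists v => //; exists s; left; exact: out_edge.
    exists (out mG s v) => //; apply/edge_out; rewrite -vz.
    by apply: fe => //; [exact: up kw|exact: out_edge].
  - have kw : near k.+1 base (inn mG s v).
      by right; exists v => //; exists s; right; exact: inn_edge.
    exists (inn mG s v) => //; apply/edge_inn; rewrite -vz.
    by apply: fe => //; [exact: up kw|exact: inn_edge].
pose F (u : gball n G) : gball n H :=
  exist _ (f (sval u)) (fnear n (leqnn n) _ (svalP u)).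
exists F; split.
- rewrite -setTT_bijective; split => //.
  + move=> u v _ _ /(congr1 sval)/= fuv; apply: sval_inj_gball.
    by apply: fI fuv; apply: (up n) => //; exact: svalP.
  + move=> [y ny] _; have [u nu uy] := lift n (leqnn n) y ny.
    by exists (exist _ u nu) => //; exact: sval_inj_gball.
- exact: sval_inj_gball.
- move=> s [u nu] [v nv] /=; have n1u := up _ _ (leqnn n) nu.
  have n1v := up _ _ (leqnn n) nv; split; first exact: fe.
  have uu' := out_edge mG s u.
  have n1u' : near n.+1 base (out mG s u) by right; exists u => //; exists s; left.
  move/(edge_out mH).
  have /(edge_out mH) <- := fe _ _ _ n1u n1u' uu'.
  by move/fI => ->.
Qed.

Lemma iso_morphism G H (f : G -> H) : marked G -> marked H -> connected G ->
  connected H -> f base = base ->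
  (forall s u v, edge s u v -> edge s (f u) (f v)) -> injective f -> iso G H.
Proof.
move=> mG mH cG cH fb fe fI; apply: agree_iso => // n.
by apply: agree_local fb _ _ => // [s u v _ _|u v _ _]; [exact: fe|exact: fI].
Qed.

(** An isomorphism of the balls of radius [n] carries the walks of length at most
    [n] from the base to each other, step by step. *)
Lemma agree_act G H n (mG : marked G) (mH : marked H) a b : agree n G H ->
  (size a <= n)%N -> (size b <= n)%N ->
  act mG a base = act mG b base -> act mH a base = act mH b base.
Proof.
move=> [f [fB fb fe]].
have nact (c : seq (gen * bool)) : (size c <= n)%N -> near n base (act mG c base).
  by move=> cn; apply: near_mono cn _; exact: act_near.
have fact (c : seq (gen * bool)) : (size c <= n)%N ->
    forall nc : near n base (act mG c base),
    sval (f (exist _ (act mG c base) nc)) = act mH c base.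
  elim: c => [_ nc|[s d] c IHc cn nc].
    by rewrite (_ : exist _ _ _ = @base (gball n G)) ?fb//; exact: sval_inj_gball.
  have {}cn : (size c < n)%N := cn.
  have {}IHc := IHc (ltnW cn) (nact c (ltnW cn)).
  rewrite [RHS]/= -IHc {IHc}; move: nc; rewrite /= /move; case: d => /= nc.
  - apply/edge_out.
    by apply/(fe s (exist _ _ (nact c (ltnW cn))) (exist _ _ nc))/out_edge.
  - apply/edge_inn.
    by apply/(fe s (exist _ _ nc) (exist _ _ (nact c (ltnW cn))))/inn_edge.
move=> an bn ab; rewrite -(fact a an (nact a an)) -(fact b bn (nact b bn)).
by congr (sval (f _)); exact: sval_inj_gball.
Qed.

Lemma iso_class_eq G H : iso G H -> iso_class G = iso_class H.
Proof.
move=> GH; apply/seteqP; split => K /=; first exact: iso_trans (iso_sym GH).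
exact: iso_trans GH.
Qed.

End agreement.

(** * Convergence in the space of pointed marked graphs *)

Section closure.
Variable R : realType.
Implicit Types (x y : graph_space R) (G H : ptgraph).

Lemma repr_graphP x : [/\ marked (repr_graph x), connected (repr_graph x) &
  carrier x = iso_class (repr_graph x)].
Proof. by rewrite /repr_graph; case: cid2 => G /= [mG cG] ->. Qed.

Lemma agree_gdist n G H : agree n G H -> gdist R G H <= 2 ^- n.
Proof.
move=> nGH; rewrite /gdist; case: asboolP => _; first by rewrite invr_ge0 exprn_ge0.
apply: ge_inf; last by right; exists n.
by exists 0 => _ [->|[m _ <-]] //; rewrite invr_ge0 exprn_ge0.
Qed.

Lemma gdist_agree n G H : gdist R G H < 2 ^- n -> agree n G H.
Proof.
rewrite /gdist; case: asboolP => [/(@iso_agree n)//|_] /inf_lt[|y [->|[m mGH <-]]].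
- by exists 2; left.
- move=> lt2; exfalso; move: lt2; apply/negP; rewrite -leNgt.
  by apply: (@le_trans _ _ 1); rewrite ?ler1n// invf_le1 ?exprn_gt0// exprn_ege1// ler1n.
- rewrite ltf_pV2 ?posrE ?exprn_gt0// ltr_eXn2l ?ltr1n// => /ltnW nm.
  exact: agree_mono mGH.
Qed.

(** The distance compares chosen representatives of the classes, but agreement of
    balls does not depend on this choice. *)
Lemma closure_agreeP (I : Type) (g : I -> ptgraph) x :
  (forall i, marked (g i) /\ connected (g i)) ->
  closure [set y | [set iso_class (g i) | i in @setT I] (carrier y)] x <->
  forall n, exists i, agree n (repr_graph x) (g i).
Proof.
move=> mg; split => [clx n|appr B /nbhs_ballP[e /= e0 xB]].
- have /clx[y [[i _ cG] xy]] : nbhs x (ball x (2 ^- n : R)).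
    by apply: nbhsx_ballx; rewrite invr_gt0 exprn_gt0.
  have [_ _ cy] := repr_graphP y.
  exists i; apply: (@iso_trans _ (gball n (repr_graph y))).
    by apply: gdist_agree; move: xy; rewrite metric_structure.ballEmdist.
  apply: iso_agree; apply: iso_sym.
  have : iso_class (repr_graph y) (repr_graph y) by exact: iso_refl.
  by rewrite -cy -cG.
- have [n ne] : exists n, 2 ^- n < e.
    have [n] := ltr_add_invr e0; rewrite add0r => ne.
    exists n; apply: le_lt_trans ne.
    rewrite lef_pV2 ?posrE ?exprn_gt0// -natrX ler_nat; exact: ltn_expl.
  have [i xG] := appr n.
  have Gin : exists2 H, marked H /\ connected H & iso_class (g i) = iso_class H.
    by exists (g i).
  exists (GraphSpace R Gin); split; first by exists i.
  have [_ _ cG] := repr_graphP (GraphSpace R Gin).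
  apply: xB; rewrite metric_structure.ballEmdist; apply: le_lt_trans ne.
  apply: agree_gdist; apply: iso_trans xG _; apply: iso_agree.
  have : iso_class (repr_graph (GraphSpace R Gin)) (repr_graph (GraphSpace R Gin)).
    exact: iso_refl.
  by rewrite -cG.
Qed.

End closure.

(** * Dyadic numbers and the orbit of one half *)

Section dyadic.
Variable R : realType.
Implicit Types (x y a b c d e h : R) (f g : R -> R) (t D : seq R).

Local Notation dyadic := (@dyadic R).

Lemma dyadic_int (m : int) : dyadic m%:~R.
Proof. by exists m, 0%N; rewrite expr0 divr1. Qed.

Lemma dyadicD x y : dyadic x -> dyadic y -> dyadic (x + y).
Proof.
move=> [m [i ->]] [n [j ->]]; exists (m * 2 ^+ j + n * 2 ^+ i), (i + j)%N.
by rewrite rmorphD !rmorphM !rmorphXn/= exprD; field; rewrite ?expf_neq0//.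
Qed.

Lemma dyadicM x y : dyadic x -> dyadic y -> dyadic (x * y).
Proof.
move=> [m [i ->]] [n [j ->]]; exists (m * n), (i + j)%N.
by rewrite rmorphM/= exprD; field; rewrite ?expf_neq0//.
Qed.

Lemma dyadicN x : dyadic x -> dyadic (- x).
Proof. by move=> dx; rewrite -mulN1r; apply: dyadicM => //; exact: (dyadic_int (-1)). Qed.

Lemma dyadicB x y : dyadic x -> dyadic y -> dyadic (x - y).
Proof. by move=> dx /dyadicN; exact: dyadicD. Qed.

Lemma dyadic2V n : dyadic (2 ^- n).
Proof. by exists 1, n; rewrite mul1r. Qed.

Lemma dyadic1 : dyadic 1. Proof. exact: (dyadic_int 1). Qed.

Lemma dyadic_half : dyadic (1 / 2).
Proof. by rewrite div1r; exact: (dyadic2V 1). Qed.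

Lemma dyadic_div2 x : dyadic x -> dyadic (x / 2).
Proof. by move=> dx; rewrite -[_^-1]div1r; apply: dyadicM => //; exact: dyadic_half. Qed.

Lemma dyadic2X (k : int) : dyadic (2 ^ k).
Proof.
case: k => n; last exact: dyadic2V.
by exists (2 ^+ n), 0%N; rewrite expr0 divr1 rmorphXn.
Qed.

End dyadic.

Section orbit.
Variable R : realType.
Implicit Types (x y a b c d e h : R) (f g : R -> R) (t D : seq R).

Local Notation dyadic := (@dyadic R).

Lemma thompson_ends f : thompsonF f -> f 0 = 0 /\ f 1 = 1.
Proof.
move=> [fI [/= fim _ fS] _ _ _].
have I0 : (0 : R) \in `[0, 1] by rewrite in_itv/= lexx ler01.
have I1 : (1 : R) \in `[0, 1] by rewrite in_itv/= lexx ler01.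
split.
- have [x xI fx] := fS 0 I0; move: (xI); rewrite /= in_itv/= => /andP[x0 _].
  move: x0; rewrite le_eqVlt => /predU1P[x0|x0]; first by rewrite {1}x0.
  have := fI _ _ I0 xI x0; have := fim 0 I0.
  by rewrite fx /= in_itv/= => /andP[f0 _] /(le_lt_trans f0); rewrite ltxx.
- have [x xI fx] := fS 1 I1; move: (xI); rewrite /= in_itv/= => /andP[_ x0].
  move: x0; rewrite le_eqVlt => /predU1P[x0|x0]; first by rewrite -{1}x0.
  have := fI _ _ xI I1 x0; have := fim 1 I1.
  by rewrite fx /= in_itv/= => /andP[_ f0] /lt_le_trans/(_ f0); rewrite ltxx.
Qed.

(** The two slopes are the one-sided limits of one difference quotient. *)
Lemma derivable_slopes f a p b (k k' c c' : R) : a < p < b ->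
  {in `[a, p], forall x, f x = k * x + c} ->
  {in `[p, b], forall x, f x = k' * x + c'} ->
  derivable f p 1 -> k = k'.
Proof.
move=> /andP[ap pb] fl fr df.
have fpl := fl p; have fpr := fr p; rewrite !in_itv/= !lexx ?(ltW ap) ?(ltW pb) in fpl fpr.
have {}fpl := fpl isT; have {}fpr := fpr isT.
pose q h := h^-1 *: ((f \o shift p) (h *: 1) - f p).
have ql : lim (q h @[h --> 0^'-]) = k.
  apply/cvg_lim => //; apply: cvg_near_cst; near=> h.
  have h0 : h < 0 by near: h; exact: nbhs_left_lt.
  rewrite /q /= fpl fl; last first.
    rewrite in_itv/= scaler1 -lerBlDr gerDr (ltW h0) andbT; near: h.
    apply: nbhs_left_ge; lra.
  rewrite scaler1 /GRing.scale/=. field; lra.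
have qr : lim (q h @[h --> 0^'+]) = k'.
  apply/cvg_lim => //; apply: cvg_near_cst; near=> h.
  have h0 : 0 < h by near: h; exact: nbhs_right_gt.
  rewrite /q /= fpr fr; last first.
    rewrite in_itv/= scaler1 lerDr (ltW h0)/= -lerBrDr; near: h.
    apply: nbhs_right_le; lra.
  rewrite scaler1 /GRing.scale/=; field; lra.
by rewrite -ql -qr -cvg_at_leftE// -cvg_at_rightE.
Unshelve. all: by end_near. Qed.

(** The constant terms of the pieces stay dyadic from left to right: at a dyadic
    breakpoint continuity transports them, and at any other breakpoint [f] is
    differentiable, so that the two pieces lie on one line. *)
Lemma thompson_dyadic f : thompsonF f -> dyadic (f (1 / 2)).
Proof.
move=> fF; have [f0 _] := thompson_ends fF.
case: fF => _ _ _ [t [tp tl tf]] [D Dd fD].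
have /(pathP 0) tlt := tp.
have tsz : (0 < size t)%N by case: (t) tl => //= /eqP; rewrite eq_sym oner_eq0.
have piece : forall i, (i < size t)%N -> exists (k : int) (c : R), dyadic c /\
    {in `[nth 0 (0 :: t) i, nth 0 t i], forall x, f x = 2 ^ k * x + c}.
  elim=> [|i IHi] it; have [k [c fc]] := tf _ it; exists k, c; split => //.
    have := fc 0; rewrite /= in_itv/= lexx (ltW (tlt _ it)) f0 => /(_ isT).
    by rewrite mulr0 add0r => <-; exact: (dyadic_int _ 0).
  have [k' [c' [dc' fc']]] := IHi (ltnW it).
  have ab := tlt _ (ltnW it); have bd := tlt _ it.
  set p := nth 0 t i in fc' ab; rewrite [nth 0 _ i.+1]/= -/p in fc bd.
  have fpl := fc p; have fpr := fc' p.
  rewrite !in_itv/= !lexx ?(ltW ab) ?(ltW bd) in fpl fpr.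
  have := fpr isT; rewrite (fpl isT) => {fpl fpr} pe.
  have [/Dd dp|pD] := boolP (p \in D).
    have -> : c = 2 ^ k' * p + c' - 2 ^ k * p by rewrite -pe; ring.
    by apply: dyadicB; [apply: dyadicD => //|]; apply: dyadicM => //; exact: dyadic2X.
  have p0 : 0 < p.
    have /allP := order_path_min (@lt_trans _ _) tp.
    by apply; apply: mem_nth; exact: ltnW.
  have p1 : p < 1.
    rewrite -tl -nth_last; apply: (sorted_ltn_nth (@lt_trans _ _)) => //.
    - exact: path_sorted tp.
    - by rewrite inE; exact: ltnW.
    - by rewrite inE prednK.
    - by rewrite -ltnS prednK.
  have pI : p \in `]0, 1[ by rewrite in_itv/= p0.
  have kk' := derivable_slopes (introT andP (conj ab bd)) fc' fc (fD _ pI pD).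
  by move: pe; rewrite kk' => /addrI ->.
have ht : has (fun x => 1 / 2 <= x) t.
  apply/hasP; exists 1; last lra.
  by rewrite -tl; case: (t) tsz => //= y s _; exact: mem_last.
set i := find (fun x => 1 / 2 <= x) t.
have it : (i < size t)%N by rewrite -has_find.
have [k [c [dc fc]]] := piece i it.
rewrite fc; first by apply: dyadicD => //; apply: dyadicM; [exact: dyadic2X|exact: dyadic_half].
rewrite in_itv/= (nth_find 0 ht) andbT.
have : forall j, (j < i)%N -> nth 0 t j < 1 / 2.
  by move=> j /(before_find 0)/negbT; rewrite -ltNge.
by case: (i) => [_|j /(_ j (ltnSn j))/ltW//]; rewrite /= divr_ge0.
Qed.

(** The increasing piecewise linear maps from [[a, b]] onto [[c, d]] with slopes
    that are powers of 2 and with dyadic breakpoints: the elements of F are the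
    case of the unit intervals, and such maps can be glued end to end. *)
Definition plmap a b c d f : Prop :=
  [/\ f a = c /\ f b = d,
      {in `[a, b] &, {homo f : x y / x < y}},
      {within `[a, b], continuous f},
      exists t, [/\ path <%R a t, last a t = b &
        forall i, (i < size t)%N -> exists (k : int) (e : R),
          {in `[nth 0 (a :: t) i, nth 0 t i], forall x, f x = 2 ^ k * x + e}] &
      exists2 D : seq R, {in D, forall x, dyadic x} &
        {in `]a, b[, forall x, x \notin D -> derivable f x 1}].

Lemma plmap_thompson f : plmap 0 1 0 1 f -> thompsonF f.
Proof.
move=> [[f0 f1] fI fC fp fD]; split => //; split.
- move=> x /=; rewrite !in_itv/= => /andP[x0 x1].
  have I0 : (0 : R) \in `[0, 1] by rewrite in_itv/= lexx ler01.
  have I1 : (1 : R) \in `[0, 1] by rewrite in_itv/= lexx ler01.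
  have xI : x \in `[0, 1] by rewrite in_itv/= x0.
  have fW := ltW_homo_in fI.
  rewrite -{1}f0 -[X in _ && (_ <= X)]f1; apply/andP.
  by split; [exact: (fW _ _ I0 xI)|exact: (fW _ _ xI I1)].
- move=> x y; rewrite !inE => xI yI fxy.
  by case: (ltgtP x y) => // /fI; [move=> /(_ xI yI)|move=> /(_ yI xI)]; rewrite fxy ltxx.
- move=> y /= yI; have [] := @IVT R f 0 1 y ler01 fC.
    by rewrite f0 f1 /Num.min /Num.max ltr01; move: yI; rewrite in_itv.
  by move=> x xI <-; exists x.
Qed.

Lemma plmap_linear a b c (k : int) : a < b ->
  plmap a b c (2 ^ k * (b - a) + c) (fun x => 2 ^ k * (x - a) + c).
Proof.
move=> ab; split.
- by rewrite subrr mulr0 add0r.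
- by move=> x y _ _ xy; rewrite ltrD2r ltr_pM2l ?exprz_gt0// ltrD2r.
- apply: continuous_subspaceT => x.
  apply: cvgD; last exact: cvg_cst.
  apply: cvgM; first exact: cvg_cst.
  by apply: cvgB; [exact: cvg_id|exact: cvg_cst].
- exists [:: b]; split => //=; first by rewrite ab.
  by case=> // _; exists k, (- (2 ^ k * a) + c) => x _; ring.
- by exists [::].
Qed.

Let path_nth_ge a t i : path <%R a t -> (i < size t)%N -> a <= nth 0 (a :: t) i.
Proof.
case: i => [//|i] /(order_path_min (@lt_trans _ _))/allP at_ it.
by apply/ltW/at_/mem_nth; exact: ltnW.
Qed.

Let path_nth_le a t i : path <%R a t -> (i < size t)%N -> nth 0 t i <= last a t.
Proof.
move=> /path_sorted ts it; rewrite -nth_last.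
rewrite (set_nth_default 0 a); last by rewrite prednK// (leq_ltn_trans _ it).
apply: (sorted_leq_nth (@le_trans _ _) (@le_refl _ _)).
- by apply: sub_sorted ts => x y; exact: ltW.
- by [].
- by rewrite inE prednK// (leq_ltn_trans _ it).
- by rewrite -ltnS prednK// (leq_ltn_trans _ it).
Qed.

Lemma plmap_glue a b e c d h f g : a < b < e -> dyadic b ->
  plmap a b c d f -> plmap b e d h g ->
  plmap a e c h (fun x => if x <= b then f x else g x).
Proof.
move=> /andP[ab be] db [[fa fb] fI fC [t [tp tl tf]] [D Dd fD]].
move=> [[gb ge] gI gC [s [sp sl sf]] [E Ed gE]].
have fgl : {in `[a, b], (fun x => if x <= b then f x else g x) =1 f}.
  by move=> x; rewrite in_itv/= => /andP[_ ->].
have fgr : {in `[b, e], (fun x => if x <= b then f x else g x) =1 g}.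
  move=> x; rewrite in_itv/= => /andP[bx _]; case: (leP x b) => // xb.
  by have -> : x = b by [apply/le_anti/andP]; rewrite fb gb.
split.
- by rewrite ltW // leNgt be.
- move=> x y; rewrite !in_itv/= => /andP[ax xe] /andP[ay ye] xy.
  case: (leP x b) => xb; case: (leP y b) => yb.
  + by apply: fI => //; rewrite in_itv/= ?ax ?ay.
  + apply: (@le_lt_trans _ _ d).
      rewrite -fb; apply: (ltW_homo_in fI) => //; rewrite in_itv/= ?ax ?lexx ?andbT//.
      exact: ltW.
    by rewrite -gb; apply: gI => //; rewrite in_itv/= ?lexx ?ye ?andbT; exact: ltW.
  + by have := lt_trans xb xy; rewrite ltNge yb.
  + by apply: gI => //; rewrite in_itv/= ?xe ?ye ?andbT; exact: ltW.
- have -> : [set` `[a, e]] = [set` `[a, b]] `|` [set` `[b, e]].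
    apply/seteqP; split => x /=; rewrite !in_itv/=.
      by move=> /andP[ax xe]; case: (leP x b) => xb; [left|right];
        apply/andP; split => //; exact: ltW.
    case=> /andP[ax xe]; apply/andP; split => //.
      by apply: le_trans xe _; exact: ltW.
    by apply: le_trans ax; exact: ltW.
  apply: withinU_continuous; [exact: interval_closed|exact: interval_closed| |].
  + apply: subspace_eq_continuous fC => x; rewrite inE => /fgl; exact: esym.
  + apply: subspace_eq_continuous gC => x; rewrite inE => /fgr; exact: esym.
- exists (t ++ s); split.
  + by rewrite cat_path tp tl.
  + by rewrite last_cat tl.
  move=> i; rewrite size_cat => its.
  have [it|ti] := ltnP i (size t).
    have [k [x fx]] := tf i it; exists k, x => y.
    rewrite -cat_cons !nth_cat it (leq_trans it)//= => yI; rewrite -fx// fgl// in_itv/=.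
    move: yI; rewrite in_itv/= => /andP[y1 y2]; apply/andP; split.
      apply: le_trans y1; exact: path_nth_ge.
    by apply: le_trans y2 _; rewrite -tl; exact: path_nth_le.
  have ist : (i - size t < size s)%N by rewrite ltn_subLR// addnC.
  have [k [x gx]] := sf _ ist; exists k, x => y.
  rewrite -cat_cons lastI tl cat_rcons !nth_cat size_belast ltnNge ti/= => yI.
  rewrite -gx// fgr// in_itv/=.
  move: yI; rewrite in_itv/= => /andP[y1 y2]; apply/andP; split.
    apply: le_trans y1; exact: path_nth_ge.
  by apply: le_trans y2 _; rewrite -sl; exact: path_nth_le.
- exists (b :: D ++ E).
    by move=> x; rewrite inE mem_cat => /predU1P[->//|/orP[/Dd|/Ed]].
  move=> x; rewrite in_itv/= => /andP[ax xe].
  rewrite inE mem_cat !negb_or => /and3P[xb xD xE].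
  case: (ltgtP x b) xb => // xb _.
  + apply: (@near_eq_derivable _ _ _ f); last by apply: fD => //; rewrite in_itv/= ax.
    near=> y; rewrite ltW//; near: y; exact: lt_nbhsl.
  + apply: (@near_eq_derivable _ _ _ g); last by apply: gE => //; rewrite in_itv/= xb.
    near=> y; rewrite leNgt ifF//; apply/negbF; near: y; exact: lt_nbhsr.
Unshelve. all: by end_near. Qed.

(** [m.+1] pieces of length [2 ^- n] on the right are matched with the pieces of
    lengths [2 ^ j / 2], [2 ^ j / 4], ..., the last of which is repeated. *)
Lemma plmap_multiple m n (j : int) a c : dyadic a ->
  exists f, plmap a (a + 2 ^ j) c (c + m.+1%:R / 2 ^+ n) f.
Proof.
move=> da; have p2 (k : int) : 0 < 2 ^ k :> R by exact: exprz_gt0.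
have lin (k : int) b h : exists f, plmap b (b + 2 ^ k) h (h + 1 / 2 ^+ n) f.
  exists (fun x => 2 ^ (- n%:Z - k) * (x - b) + h).
  have -> : h + 1 / 2 ^+ n = 2 ^ (- n%:Z - k) * (b + 2 ^ k - b) + h.
    by rewrite addrAC subrr add0r -expfzDr// subrK [RHS]addrC div1r exprnN.
  by apply: plmap_linear; rewrite ltrDl.
elim: m j a c da => [|m IHm] j a c da; first exact: lin.
have [f fP] := lin (j - 1) a c.
have db : dyadic (a + 2 ^ (j - 1)) by apply: dyadicD => //; exact: dyadic2X.
have [g gP] := IHm (j - 1) (a + 2 ^ (j - 1)) (c + 1 / 2 ^+ n) db.
exists (fun x => if x <= a + 2 ^ (j - 1) then f x else g x).
have -> : a + 2 ^ j = a + 2 ^ (j - 1) + 2 ^ (j - 1).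
  rewrite -addrA; congr (_ + _); have -> : j = 1 + (j - 1) by ring.
  by rewrite expfzDr// expr1z (_ : 1 + (j - 1) - 1 = j - 1); ring.
have -> : c + m.+2%:R / 2 ^+ n = c + 1 / 2 ^+ n + m.+1%:R / 2 ^+ n.
  by rewrite -addrA -mulrDl [m.+2%:R]mulrS.
by apply: plmap_glue fP gP => //; rewrite !ltrDl !p2.
Qed.

(** A dyadic number [x] of [(0, 1)] is the image of [1 / 2] under a map glued from
    one that takes [[0, 1/2]] to [[0, x]] and one that takes [[1/2, 1]] to
    [[x, 1]]; both target lengths are multiples of the same [2 ^- n]. *)
Lemma orbit_halfE : @orbit_half R = dyadic `&` `]0, 1[.
Proof.
apply/seteqP; split => [_ [f fF <-]|x [[m [n xE]]]].
- split; first exact: thompson_dyadic.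
  have [f0 f1] := thompson_ends fF; case: fF => fI _ _ _ _.
  rewrite /= in_itv/= -{1}f0 -[X in _ && (_ < X)]f1.
  by apply/andP; split; apply: fI; rewrite ?in_itv/=; lra.
- rewrite /= in_itv/= => /andP[x0 x1].
  have d0 : dyadic 0 by exact: (dyadic_int _ 0).
  have p2 : 0 < 2 ^+ n :> R by exact: exprn_gt0.
  have [k xk] : exists k, x = k.+1%:R / 2 ^+ n.
    move: x0; rewrite xE pmulr_lgt0 ?invr_gt0// ltr0z.
    by case: m {xE} => [[//|k] _|//]; exists k.
  have [l xl] : exists l, 1 - x = l.+1%:R / 2 ^+ n.
    have kn : (k.+1 < 2 ^ n)%N.
      by rewrite -(ltr_nat R) natrX; move: x1; rewrite xk ltr_pdivrMr// mul1r.
    exists (2 ^ n - k.+1).-1%N.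
    rewrite prednK ?subn_gt0// natrB; last exact: ltnW.
    by rewrite xk natrX mulrBl divff ?gt_eqF.
  have [f fP] := plmap_multiple k n (-1) 0 d0.
  have [g gP] := plmap_multiple l n (-1) x (dyadic_half R).
  exists (fun y => if y <= 1 / 2 then f y else g y).
    apply: plmap_thompson.
    have fP' : plmap 0 (1 / 2) 0 x f.
      by move: fP; rewrite !add0r -xk exprN1 div1r.
    have gP' : plmap (1 / 2) 1 x 1 g.
      move: gP; rewrite -xl (_ : x + (1 - x) = 1); last ring.
      by rewrite exprN1 (_ : 1 / 2 + 2^-1 = 1 :> R) //; lra.
    apply: plmap_glue fP' gP'; last exact: dyadic_half.
    lra.
  case: fP => -[_]; rewrite !add0r exprN1 -xk div1r => fx _ _ _ _.
  by rewrite ifT.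
Qed.

End orbit.

(** * The Schreier graph of the dyadic numbers *)

(* Innermost case distinctions are split first, so that the hypotheses they
   leave are linear. *)
Ltac affine_cases := rewrite ?/x0_map ?/x1_map;
  repeat match goal with H : _ <-> _ |- _ => clear H end;
  repeat match goal with |- context [if ?a <= ?b then _ else _] =>
    lazymatch a with
    | context [if _ then _ else _] => fail
    | _ => case: (leP a b) => ?; try lra
    end
  end; lra.

Section schreier_graph.
Variable R : realType.
Implicit Types (x y z : R) (s : gen) (l : gen * bool) (a : seq (gen * bool)).

Local Notation dyadic := (@dyadic R).
Local Notation V := {x : R | orbit_half x}.

Lemma orbit_halfP x : orbit_half x <-> dyadic x /\ 0 < x < 1.
Proof. by rewrite orbit_halfE /= in_itv. Qed.

Definition smap s : R -> R := if s is X0 then @x0_map R else @x1_map R.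

Definition sinv s x : R :=
  if s is X0 then
    if x <= 1 / 4 then 2 * x else if x <= 1 / 2 then x + 1 / 4 else (x + 1) / 2
  else
    if x <= 1 / 2 then x else if x <= 5 / 8 then 2 * x - 1 / 2
    else if x <= 3 / 4 then x + 1 / 8 else (x + 1) / 2.

Lemma smapK s x : sinv s (smap s x) = x.
Proof. by case: s => /=; affine_cases. Qed.

Lemma sinvK s x : smap s (sinv s x) = x.
Proof. by case: s => /=; affine_cases. Qed.

Lemma dyadic_nat n : dyadic n%:R.
Proof. exact: (dyadic_int _ n%:Z). Qed.

Lemma dyadic_div4 x : dyadic x -> dyadic (x / 4).
Proof.
move=> dx; rewrite (_ : x / 4 = x / 2 / 2); last lra.
by do 2 apply: dyadic_div2.
Qed.

Lemma dyadic_div8 x : dyadic x -> dyadic (x / 8).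
Proof.
move=> dx; rewrite (_ : x / 8 = x / 2 / 4); last lra.
by apply/dyadic_div4/dyadic_div2.
Qed.

Ltac dyadic_tac := repeat first [assumption | exact: dyadic_nat | exact: dyadic1
  | apply: dyadicB | apply: dyadicD | apply: dyadic_div2 | apply: dyadic_div4
  | apply: dyadic_div8 | apply: dyadicM].

Lemma smap_orbit s x : orbit_half x -> orbit_half (smap s x).
Proof.
move=> /orbit_halfP[dx x01]; apply/orbit_halfP; split.
  by case: s => /=; rewrite ?/x0_map ?/x1_map; repeat case: ifP => _; dyadic_tac.
by case: s => /=; affine_cases.
Qed.

Lemma sinv_orbit s x : orbit_half x -> orbit_half (sinv s x).
Proof.
move=> /orbit_halfP[dx x01]; apply/orbit_halfP; split.
  by case: s => /=; repeat case: ifP => _; dyadic_tac.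
by case: s => /=; affine_cases.
Qed.

Lemma V_eq (u v : V) : sval u = sval v -> u = v.
Proof. by case: u v => [x hx] [y hy] /= xy; exact: eq_exist. Qed.

Lemma schreier_edge (q : V) s (u v : schreier q) :
  edge s u v <-> smap s (sval u) = sval v.
Proof. by case: s. Qed.

Lemma schreier_marked (q : V) : marked (schreier q).
Proof.
split => s u.
- exists (exist _ (smap s (sval u)) (smap_orbit s (svalP u))).
  by split => [|v /schreier_edge uv]; [exact/schreier_edge|exact: V_eq].
- exists (exist _ (sinv s (sval u)) (sinv_orbit s (svalP u))).
  split => [|v /schreier_edge uv]; first by apply/schreier_edge; rewrite /= sinvK.
  by apply: V_eq; rewrite /= -uv smapK.
Qed.

Lemma sval_out (q : V) s (u : schreier q) :
  sval (out (schreier_marked q) s u) = smap s (sval u).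
Proof. by have /schreier_edge <- := out_edge (schreier_marked q) s u. Qed.

Lemma sval_inn (q : V) s (u : schreier q) :
  sval (inn (schreier_marked q) s u) = sinv s (sval u).
Proof.
have /schreier_edge := inn_edge (schreier_marked q) s u.
by move=> <-; rewrite smapK.
Qed.

(** The actions of a letter and of a word on numbers, to compute with. *)
Definition rmove l x := if l.2 then smap l.1 x else sinv l.1 x.
Definition ract a x := foldr rmove x a.

Lemma sval_act (q : V) a (u : schreier q) :
  sval (act (schreier_marked q) a u) = ract a (sval u).
Proof.
elim: a => //= -[s d] a <-; rewrite /move /rmove /=.
by case: d; [exact: sval_out|exact: sval_inn].
Qed.

(** At every point some word of length at most three acts as [2 * x - e / 4] with
    [e] an integer. This lowers the exponent of the denominator as long as it
    exceeds two, so that every vertex is connected to one of [1/4], [1/2] and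
    [3/4]. *)
Lemma schreier_connected (q : V) : connected (schreier q).
Proof.
have h12 : orbit_half (1 / 2 : R).
  by apply/orbit_halfP; split; [exact: dyadic_half|lra].
pose h : schreier q := exist _ _ h12.
apply: (@connected_hub (schreier q) h) => u.
have step w (v : schreier q) : sval v = ract w (sval u) -> conn v h -> conn u h.
  move=> vE; apply: conn_trans; exists (size w).
  rewrite (_ : v = act (schreier_marked q) w u); first exact: act_near.
  by apply: V_eq; rewrite sval_act.
have [[m [n uE]] u01] := (orbit_halfP (sval u)).1 (svalP u).
have {uE} : exists (m : int) n, sval u = m%:~R / 2 ^+ n.+2.
  by exists (m * 4), n; rewrite uE rmorphM/= !exprS; field; rewrite expf_neq0.
move=> {m n} [m [n]].
elim: n m u u01 step => [|n IHn] m u u01 step uE.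
  have : 0 < m < 4 by rewrite -!(ltr_int R); move: u01; rewrite uE; lra.
  have {uE} : sval u = m%:~R / 4 by rewrite uE; lra.
  case: m => [[|[|[|[|m]]]]|m] // uE _; rewrite /= in uE.
  - apply: (step [:: (X0, false)] h); last exact: conn_refl.
    by rewrite uE /ract /rmove /= ifT; lra.
  - by rewrite (_ : u = h); [exact: conn_refl|apply: V_eq; rewrite uE /=; lra].
  - apply: (step [:: (X0, true)] h); last exact: conn_refl.
    by rewrite uE /ract /rmove /= /x0_map; repeat case: leP => ?; lra.
have [w [e wE]] : exists w (e : int), ract w (sval u) = 2 * sval u - e%:~R / 4.
  have [?|?] := leP (sval u) (1 / 4).
    by exists [:: (X0, false)], 0; rewrite /ract /rmove /= ifT; lra.
  have [?|?] := leP (sval u) (3 / 8).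
    exists [:: (X1, false); (X0, false)], 0; rewrite /ract /rmove /sinv /=.
    by affine_cases.
  have [?|?] := leP (sval u) (1 / 2).
    exists [:: (X0, true); (X1, false); (X0, false)], 1; rewrite /ract /rmove /sinv /=.
    by affine_cases.
  have [?|?] := leP (sval u) (5 / 8).
    exists [:: (X1, false)], 2; rewrite /ract /rmove /sinv /=.
    by affine_cases.
  have [?|?] := leP (sval u) (3 / 4).
    exists [:: (X0, true); (X1, false)], 3; rewrite /ract /rmove /sinv /=.
    by affine_cases.
  exists [:: (X0, true)], 4; rewrite /ract /rmove /=.
  by affine_cases.
apply: (step w (act (schreier_marked q) w u)); first by rewrite sval_act.
have v01 := ((orbit_halfP _).1 (svalP (act (schreier_marked q) w u))).2.
apply: (IHn (m - e * 2 ^+ n)) => //.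
  move=> w' v vE; apply: conn_trans; exists (size w').
  rewrite (_ : v = act (schreier_marked q) w' (act (schreier_marked q) w u)).
    exact: act_near.
  by apply: V_eq; rewrite sval_act.
rewrite sval_act wE uE rmorphB rmorphM rmorphXn/= !exprS; field.
by rewrite expf_neq0.
Qed.

End schreier_graph.

(** * The graphs P(w) *)

Section grey_tree.
Implicit Types (w : word) (b : bool) (v : grey).

Definition parent v : grey :=
  match v with
  | Dgrey k (_ :: p) => Dgrey k p
  | Dgrey k [::] => Spine k.-1
  | Spine k => Spine k.+1
  end.

Definition letter w v : bool :=
  match v with
  | Dgrey _ (b :: _) => b
  | Dgrey 0 [::] => w 0%N
  | Dgrey k.+1 [::] => ~~ w k
  | Spine k => w k.+1
  end.

Lemma child_letter_parent w v : child w (letter w v) (parent v) = v.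
Proof. by case: v => [[|k] [|b p]|k] //=; rewrite ?eqxx//; case: (w k). Qed.

Lemma parent_child w b v : parent (child w b v) = v.
Proof. by case: v => [k p|[|k]] //=; case: eqP. Qed.

Lemma letter_child w b v : letter w (child w b v) = b.
Proof. case: v => [[|k] p|[|k]] //=.
  by case: b; case E: (w 0%N) => //=; rewrite E.
by case: b; case E: (w k.+1) => //=; rewrite E. Qed.

Lemma grey_ind_tree (P : grey -> Prop) w :
  P (gvert 0) -> (forall b v, P v <-> P (child w b v)) -> forall v, P v.
Proof.
move=> P0 Pc; have Pg k : P (gvert k).
  elim: k => // k IHk; apply/(Pc (w k)); rewrite /= eqxx.
  exact: IHk.
case=> [k p|k]; last exact: (Pg k.+1).
elim: p => [|b p IHp]; last exact: (Pc b (Dgrey k p)).1 IHp.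
case: k => [|k]; first exact: P0.
by have /(Pc (~~ w k)) := Pg k.+1; rewrite /=; case: (w k).
Qed.

(** It changes by at most one along every edge, and it exceeds the index of each
    letter of [w] that decides which are the children of [v]. *)
Definition height v : nat :=
  match v with Dgrey k p => (k + size p)%N | Spine k => k.+1 end.

Lemma height_child w b v : (height (child w b v) <= (height v).+1)%N.
Proof.
by case: v => [k p|[|k]] /=; try case: eqP => _ /=; lia.
Qed.

Lemma height_parent w b v : (height v <= (height (child w b v)).+1)%N.
Proof.
by case: v => [k p|[|k]] /=; try case: eqP => _ /=; lia.
Qed.

Lemma iter_parent v N : (height v <= N)%N ->
  exists2 i, (i < N.*2.+2)%N & iter N.+1 parent v = Spine i.
Proof.
have itS m k : iter m parent (Spine k) = Spine (k + m).
  by elim: m => [|m IHm]; rewrite ?addn0//= IHm addnS.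
have itD p k : iter (size p) parent (Dgrey k p) = Dgrey k [::].
  by elim: p => //= b p IHp; rewrite -iterS iterSr.
case: v => [k p|k] /= hN; last first.
  by exists (k + N).+1 => //; [lia|rewrite itS].
exists (k.-1 + (N - size p))%N; first by lia.
have {1}-> : N = (N - size p + size p)%N by lia.
by rewrite iterD itD -iterS iterSr /= itS.
Qed.

(** Nodes with equal values have equal letters, and their ancestors have equal
    values as well; as the branch of a node joins the spine, injectivity on the
    spine suffices. *)
Lemma grey_injective (Y : Type) w (f : grey -> Y) N :
  (forall u v, f u = f v -> letter w u = letter w v /\ f (parent u) = f (parent v)) ->
  (forall i j, (i < N.*2.+2)%N -> (j < N.*2.+2)%N ->
    f (Spine i) = f (Spine j) -> i = j) ->
  forall u v, (height u <= N)%N -> (height v <= N)%N -> f u = f v -> u = v.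
Proof.
move=> fp fs u v hu hv fuv.
have lift K : forall x y, f x = f y -> iter K parent x = iter K parent y -> x = y.
  elim: K => // K IHK x y fxy; rewrite !iterSr => pxy.
  have [lxy fpxy] := fp _ _ fxy.
  by rewrite -(child_letter_parent w x) -(child_letter_parent w y) lxy (IHK _ _ fpxy pxy).
have fK K : f (iter K parent u) = f (iter K parent v).
  by elim: K => //= K /fp[].
have [i iN ui] := iter_parent hu; have [j jN vj] := iter_parent hv.
apply: (lift N.+1) => //; rewrite ui vj; congr Spine.
by apply: fs => //; rewrite -ui -vj.
Qed.

End grey_tree.

Section grey_extension.
Variables (Y : Type) (w : word) (ch : bool -> Y -> Y) (sp : nat -> Y).

(** The map on the tree that has the values [sp k] on the spine and turns
    [child w] into [ch]. *)
Definition extend (v : grey) : Y :=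
  match v with
  | Dgrey k p => foldr ch (if k is j.+1 then ch (~~ w j) (sp k) else sp 0%N) p
  | Spine k => sp k.+1
  end.

Lemma extend_gvert k : extend (gvert k) = sp k.
Proof. by case: k. Qed.

Lemma extend_child b v : (forall k, sp k = ch (w k) (sp k.+1)) ->
  extend (child w b v) = ch b (extend v).
Proof.
move=> spE; case: v => [k p|k] //=.
case: eqP => [->|/eqP bw]; first by rewrite extend_gvert spE.
by rewrite /= (_ : ~~ w k = b)//; move: bw; case: b; case: (w k).
Qed.

Lemma extend_ind (P : Y -> Prop) : (forall k, P (sp k)) ->
  (forall b y, P y -> P (ch b y)) -> forall v, P (extend v).
Proof.
move=> Psp Pch [k p|k] //=; elim: p => [|b p IHp] /=; last exact: Pch.
by case: k => [|k]; [|apply: Pch].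
Qed.

End grey_extension.

Section P_graph.
Implicit Types (w : word) (u : pvert) (v : grey) (s : gen).

Definition pout w s u : pvert :=
  match u, s with
  | Grey v, X0 => Black v 0
  | Grey v, X1 => Grey (child w false v)
  | White v 0, X0 => Grey v
  | White v 0, X1 => Grey (child w true v)
  | White v i.+1, _ => White v i
  | Black v i, X0 => Black v i.+1
  | Black v i, X1 => Black v i
  end.

Definition pinn w s u : pvert :=
  match u, s with
  | Grey v, X0 => White v 0
  | Grey v, X1 => if letter w v then White (parent v) 0 else Grey (parent v)
  | White v i, _ => White v i.+1
  | Black v 0, X0 => Grey v
  | Black v i.+1, X0 => Black v i
  | Black v i, X1 => Black v i
  end.

Lemma poutK w s : cancel (pout w s) (pinn w s).
Proof.
by case: s => -[v|v [|i]|v i] //=; rewrite ?letter_child ?parent_child//; case: i.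
Qed.

Lemma pinnK w s : cancel (pinn w s) (pout w s).
Proof.
case: s => -[v|v [|i]|v [|i]] //=.
by case: ifP => lv /=; rewrite -lv child_letter_parent.
Qed.

Lemma pedgeE w s u u' : pedge w s u u' <-> u' = pout w s u.
Proof.
split => [|->]; first by case => // v [|i].
case: s u => -[v|v [|i]|v i] /=.
- exact: pedge0_grey.
- exact: pedge0_white1.
- exact: (@pedge0_white w v i.+1).
- exact: (@pedge0_black w v i.+1).
- exact: pedge1_grey.
- exact: pedge1_white1.
- exact: (@pedge1_white w v i.+1).
- exact: (@pedge1_black w v i.+1).
Qed.

Lemma P_marked w u0 : marked (Pgraph w u0).
Proof.
split => s u.
- by exists (pout w s u); split => [|u' /pedgeE]; first exact/pedgeE.
- exists (pinn w s u); split => [|u' /pedgeE ->]; last by rewrite poutK.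
  by apply/pedgeE; rewrite pinnK.
Qed.

Definition ptree u : grey :=
  match u with Grey v => v | White v _ => v | Black v _ => v end.

Lemma P_connected w u0 : connected (Pgraph w u0).
Proof.
pose G := Pgraph w u0.
have E s (u : G) : conn u (pout w s u : G) by apply: (@conn_edge G s); exact/pedgeE.
have E' s (u : G) : conn (pout w s u : G) u by exact: conn_sym.
apply: (@connected_hub G (Grey (gvert 0))) => u.
apply: (@conn_trans G _ (Grey (ptree u))).
  case: u => [v|v i|v i]; first exact: conn_refl.
    elim: i => [|i IHi]; first exact: (E X0 (White v 0)).
    exact: conn_trans (E X0 (White v i.+1)) IHi.
  elim: i => [|i IHi]; first exact: (E' X0 (Grey v)).
  exact: conn_trans (E' X0 (Black v i)) IHi.
have step b v : conn (Grey v : G) (Grey (child w b v) : G).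
  case: b; last exact: (E X1 (Grey v)).
  exact: (conn_trans (E' X0 (White v 0)) (E X1 (White v 0))).
move: (ptree u); apply: (@grey_ind_tree _ w); first exact: conn_refl.
by move=> b v; split; apply: conn_trans; [exact/conn_sym|exact: step].
Qed.

Lemma height_near w u0 n (u : Pgraph w u0) : near n (base : Pgraph w u0) u ->
  (height (ptree u) <= height (ptree u0) + n)%N.
Proof.
have step s (x y : Pgraph w u0) : edge s x y ->
    (height (ptree x) <= (height (ptree y)).+1)%N /\
    (height (ptree y) <= (height (ptree x)).+1)%N.
  move=> /pedgeE ->; case: s x => -[v|v [|i]|v i] //=;
  by rewrite ?height_child ?height_parent ?leqnSn.
elim: n u => [u <-|n IHn u /= [/IHn|]]; [by rewrite addn0|lia|].
by move=> [x /IHn hx [s [/step[]|/step[]]]]; lia.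
Qed.

(** Only the letters of [w] up to the height of a vertex determine its edges. *)
Lemma P_agree w w' u0 n :
  (forall i, (i <= height (ptree u0) + n)%N -> w i = w' i) ->
  agree n (Pgraph w u0) (Pgraph w' u0).
Proof.
move=> ww'; pose f (u : Pgraph w u0) : Pgraph w' u0 := u.
apply: (@agree_local _ _ n f) => //; [exact: P_marked|exact: P_marked|].
move=> s u v /height_near hu _ /pedgeE ->; apply/pedgeE.
have childE b x : (height x <= height (ptree u0) + n.+1)%N ->
    child w b x = child w' b x.
  by case: x => //= k; rewrite addnS ltnS => /ww' ->.
by case: s u hu => -[x|x [|i]|x i] //= hu; rewrite childE.
Qed.

End P_graph.

Section P_morphism.
Variables (H : ptgraph) (mH : marked H) (w : word) (g : grey -> H).

(** A map [g] on the grey vertices extends in only one way to a map that respects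
    the edges labeled [x_0], since every orbit of [x_0] contains a grey vertex. *)
Definition place (u : pvert) : H :=
  match u with
  | Grey v => g v
  | White v i => iter i.+1 (inn mH X0) (g v)
  | Black v i => iter i.+1 (out mH X0) (g v)
  end.

Lemma place_edge :
  (forall v i, out mH X1 (iter i.+1 (out mH X0) (g v)) = iter i.+1 (out mH X0) (g v)) ->
  (forall v i, out mH X1 (iter i.+2 (inn mH X0) (g v)) = iter i.+1 (inn mH X0) (g v)) ->
  (forall v, out mH X1 (inn mH X0 (g v)) = g (child w true v)) ->
  (forall v, out mH X1 (g v) = g (child w false v)) ->
  forall s u u', pedge w s u u' -> edge s (place u) (place u').
Proof.
move=> gb gw gl gr s u _ /pedgeE ->; apply/(edge_out mH).
by case: s u => -[v|v [|i]|v i] //=; rewrite ?innK ?gl ?gr// ?[RHS]gb ?[RHS]gw.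
Qed.

Lemma place_inj :
  (forall v v' k, iter k (out mH X0) (g v) = g v' -> k = 0%N) ->
  forall u u', place u = place u' ->
    g (ptree u) = g (ptree u') /\ (ptree u = ptree u' -> u = u').
Proof.
move=> sep u u' uu'.
pose wh x := if x is White _ i then i.+1 else 0%N.
pose bl x := if x is Black _ i then i.+1 else 0%N.
have inj k : injective (iter k (out mH X0)).
  by elim: k => // k IHk x y /= /(can_inj (outK mH X0))/IHk.
have cancel_iter k y : iter k (out mH X0) (iter k (inn mH X0) y) = y.
  by elim: k => // k IHk; rewrite iterSr iterS innK.
(* A large number [N] of steps along [x_0] moves the images of white vertices
   beyond the grey ones, so that no negative offsets remain. *)
have placeE x N : (wh x <= N)%N ->
    iter N (out mH X0) (place x) = iter (N - wh x + bl x) (out mH X0) (g (ptree x)).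
  case: x => [v|v i|v i] /= iN; rewrite ?subn0 ?addn0//; last by rewrite -iterS -iterD.
  have {1}-> : N = (N - i.+1 + i.+1)%N by rewrite subnK.
  by rewrite iterD -iterS cancel_iter.
have cmp v v' e e' : (e <= e')%N ->
    iter e (out mH X0) (g v) = iter e' (out mH X0) (g v') -> e = e' /\ g v = g v'.
  move=> ee'; rewrite -{1}(subnKC ee') iterD => /inj /esym gv.
  by have k0 := sep _ _ _ gv; move: gv; rewrite k0 /= => ->; split => //; lia.
have {cmp}cmp v v' e e' :
    iter e (out mH X0) (g v) = iter e' (out mH X0) (g v') -> e = e' /\ g v = g v'.
  by case/orP: (leq_total e e') => ee' E; [exact: cmp|case: (cmp _ _ _ _ ee' (esym E))].
pose N := (wh u + wh u')%N.
have := congr1 (iter N (out mH X0)) uu'.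
rewrite !placeE ?leq_addr ?leq_addl// => /cmp[off ->]; split=> //.
move: off; rewrite /N; case: u {uu' N} => [v|v i|v i]; case: u' => [v'|v' i'|v' i'] /= off tv;
  rewrite tv; (try by exfalso; lia) => //.
- by congr White; lia.
- by congr Black; lia.
Qed.

End P_morphism.

(** * Approximation of P(w) and of the lines by Schreier graphs *)

Section level.
Variable R : realType.
Implicit Types (x : R) (b : bool) (w : word) (d : nat).

(** [x] has denominator exactly [2 ^+ d]. *)
Definition level d x := exists m : int, x = (2 * m + 1)%:~R / 2 ^+ d.

Lemma level_lt_neq d e x : (d < e)%N -> level d x -> level e x -> False.
Proof.
move=> de [m ->] [n]; rewrite -(subnKC de).
set k := (e - d.+1)%N => mn.
have : (2 * m + 1)%:~R * 2 ^+ k.+1 = (2 * n + 1)%:~R :> R.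
  have p0 i : 2 ^+ i != 0 :> R by rewrite expf_neq0.
  apply: (mulIf (invr_neq0 (p0 (d.+1 + k)%N))); rewrite -mn addSnnS exprD.
  by field; rewrite !p0.
have -> : 2 ^+ k.+1 = (2 * 2 ^+ k)%:~R :> R by rewrite exprS rmorphM rmorphXn.
rewrite -rmorphM => /intr_inj; move: (2 ^+ k) => t; rewrite mulrCA.
by move: (_ * t) => r; lia.
Qed.

Lemma level_uniq d e x : level d x -> level e x -> d = e.
Proof.
by move=> dx ex; case: (ltngtP d e) => // de; [case: (level_lt_neq de dx ex)|
  case: (level_lt_neq de ex dx)].
Qed.

(** The binary digit [b] is put in front of the digits of [x]. *)
Definition halve b x := (b%:R + x) / 2.

Lemma halve_level b d x : level d.+1 x -> level d.+2 (halve b x).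
Proof.
move=> [m ->]; exists (b%:Z * 2 ^+ d + m).
rewrite /halve !rmorphD/= !rmorphM/= !rmorphD/= rmorphM/= rmorphXn/= !exprS.
by field; rewrite expf_neq0.
Qed.

Lemma halve_inj b b' x y : 0 <= x < 1 -> 0 <= y < 1 -> halve b x = halve b' y ->
  b = b' /\ x = y.
Proof. by rewrite /halve; case: b; case: b' => /= x01 y01 xy; split => //; lra. Qed.

Lemma halve_bounds b x : 0 <= x < 1 -> 0 <= halve b x < 1.
Proof. by rewrite /halve; case: b => /= x01; lra. Qed.

Lemma halve_dyadic b x : dyadic x -> dyadic (halve b x).
Proof. by move=> dx; apply/dyadic_div2/dyadicD => //; exact: dyadic_nat. Qed.

Lemma dyadic_level x : dyadic x -> 0 < x < 1 -> exists d, level d.+1 x.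
Proof.
move=> [m [n ->]]; elim: n m => [m|n IHn m] x01.
  by move: x01; rewrite expr0 divr1 ltr0z ltrz1; lia.
have [[k mk]|[k mk]] : (exists k, m = 2 * k) \/ (exists k, m = 2 * k + 1).
- have := divz_eq m 2; have := modz_ge0 m (isT : 2 != 0 :> int).
  have := ltz_pmod m (isT : 0 < 2 :> int); move: (m %/ 2)%Z (m %% 2)%Z => q r r2 r0 ->.
  by have [->|->] : r = 0 \/ r = 1; [lia|left; exists q; lia|right; exists q; lia].
- have mE : m%:~R / 2 ^+ n.+1 = k%:~R / 2 ^+ n :> R.
    by rewrite mk rmorphM/= exprS; field; rewrite expf_neq0.
  by rewrite mE; apply: IHn; rewrite -mE.
- by exists n, k; rewrite mk.
Qed.

End level.

Section approximation.
Variable R : realType.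
Implicit Types (x z : R) (w : word) (v : grey) (u : pvert) (m n k : nat).

Local Notation V := {x : R | orbit_half x}.

Definition dyadic_word m w : word := fun i => if (i < m)%N then w i else i == m.

(** The number with the [d] binary digits [w (m - d)], ..., [w m.-1] and a last
    digit 1. *)
Fixpoint dyadic_tail m w d : R :=
  if d is e.+1 then halve (w (m - d)%N) (dyadic_tail m w e) else 1 / 2.

(** The number with the binary digits [dyadic_word m w k], [dyadic_word m w k.+1],
    and so on. *)
Definition spine_value m w k : R := if (k <= m)%N then dyadic_tail m w (m - k) else 0.

Lemma spine_valueE m w k :
  spine_value m w k = halve (dyadic_word m w k) (spine_value m w k.+1).
Proof.
rewrite /spine_value /dyadic_word /halve.
case: ltngtP => [km|mk|->]; rewrite ?subnn/=; [|lra|lra].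
have -> : (m - k)%N = (m - k.+1).+1 by lia.
by rewrite /= (_ : (m - _)%N = k)//; lia.
Qed.

Lemma dyadic_tail_level m w d : level d.+1 (dyadic_tail m w d).
Proof.
elim: d => [|d IHd]; first by exists 0; rewrite mulr0 add0r expr1.
exact: halve_level.
Qed.

Lemma spine_value_inj m w i j : (i <= m)%N -> (j <= m)%N ->
  spine_value m w i = spine_value m w j -> i = j.
Proof.
rewrite /spine_value => im jm; rewrite im jm => ij.
have := dyadic_tail_level m w (m - i); rewrite ij.
by move=> /level_uniq/(_ (dyadic_tail_level _ _ _))[]; lia.
Qed.

Lemma spine_value_bounds m w k : dyadic (spine_value m w k) /\
  0 <= spine_value m w k < 1.
Proof.
rewrite /spine_value; case: ifP => _; last first.
  by split; [exact: (dyadic_nat R 0)|rewrite lexx ltr01].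
elim: (m - k)%N => [|d [dd d01]] /=; first by split; [exact: dyadic_half|lra].
by split; [exact: halve_dyadic|exact: halve_bounds].
Qed.

Definition grey_value m w : grey -> R :=
  extend (dyadic_word m w) (@halve R) (spine_value m w).

Lemma grey_value_child m w b v :
  grey_value m w (child (dyadic_word m w) b v) = halve b (grey_value m w v).
Proof. apply: extend_child; exact: spine_valueE. Qed.

Lemma grey_value_bounds m w v : dyadic (grey_value m w v) /\ 0 <= grey_value m w v < 1.
Proof.
apply: (@extend_ind R _ _ _ (fun x => dyadic x /\ 0 <= x < 1)) => [k|b x [dx x01]].
  exact: spine_value_bounds.
by split; [exact: halve_dyadic|exact: halve_bounds].
Qed.

(** The numbers on the spine up to height [m] have pairwise different
    denominators. *)
Lemma grey_value_inj m w N : (N.*2.+2 <= m)%N -> forall v v',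
  (height v <= N)%N -> (height v' <= N)%N ->
  grey_value m w v = grey_value m w v' -> v = v'.
Proof.
move=> Nm; apply: (@grey_injective _ (dyadic_word m w)) => [v v'|i j iN jN].
  rewrite -{1}(child_letter_parent (dyadic_word m w) v).
  rewrite -{1}(child_letter_parent (dyadic_word m w) v') !grey_value_child.
  by apply: halve_inj; exact: (grey_value_bounds _ _ _).2.
by move=> /spine_value_inj; rewrite !(leq_trans _ Nm)// => /(_ isT isT)[].
Qed.

Lemma iter_x0_lt z k : 0 < z < 3 / 4 -> iter k.+1 (@x0_map R) z < 1 / 2.
Proof.
move=> z01; suff : 0 < iter k.+1 (@x0_map R) z < 1 / 2 by case/andP.
elim: k => [|k IHk]; first by rewrite /=; affine_cases.
by rewrite iterS; move: (iter _ _ _) IHk => y y01; affine_cases.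
Qed.

Lemma iter_x0V_ge z k : 1 / 2 <= z < 1 -> 3 / 4 <= iter k.+1 (@sinv R X0) z < 1.
Proof.
move=> z01; elim: k => [|k IHk]; first by rewrite /=; affine_cases.
by rewrite iterS; move: (iter _ _ _) IHk => y y01 /=; affine_cases.
Qed.

(** P(w) agrees near the base with P(w') for [w' = dyadic_word m w]. The labels
    of P(w') are eventually zero, so that they are the binary expansions of
    dyadic numbers, and a grey vertex with label [10u] is sent to
    [1 / 2 + y / 4] for the number [y] with digits [u]. This is a covering of the
    Schreier graph, injective up to a height that grows with [m]. *)
Lemma P_approx w u0 n : exists q : V, agree n (Pgraph w u0) (schreier q).
Proof.
pose N := (height (ptree u0) + n.+1)%N; pose m := N.*2.+2.
pose w' := dyadic_word m w; pose x v := grey_value m w v.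
have zP v : orbit_half (1 / 2 + x v / 4).
  have [dx x01] := grey_value_bounds m w v; rewrite -/(x v) in dx x01.
  apply/orbit_halfP; split; last lra.
  by apply: dyadicD; [exact: dyadic_half|exact: dyadic_div4].
pose h0 : V := exist _ _ (zP (gvert 0)).
pose g v : schreier h0 := exist _ _ (zP v).
pose mS := schreier_marked h0.
have z34 v : 1 / 2 <= sval (g v) < 3 / 4.
  by rewrite /=; have [_] := grey_value_bounds m w v; rewrite -/(x v); lra.
have itO k (y : schreier h0) : sval (iter k (out mS X0) y) = iter k (@x0_map R) (sval y).
  by elim: k => //= k <-; rewrite sval_out.
have itI k (y : schreier h0) : sval (iter k (inn mS X0) y) = iter k (sinv X0) (sval y).
  by elim: k => // k IHk; rewrite !iterS -IHk sval_inn.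
have xc b v : x (child w' b v) = halve b (x v) by exact: grey_value_child.
pose f : pvert -> schreier h0 := place mS g.
exists (f u0).
apply: (@iso_trans _ (gball n (Pgraph w' u0))).
  apply: P_agree => i iN; rewrite /w' /dyadic_word ifT//.
  by rewrite /m /N; lia.
have fe : forall s u u', pedge w' s u u' -> edge s (f u) (f u').
  (* Starting from [[1/2, 3/4)], the iterates of [x_0] lie in the half that is fixed
     by [x_1], and those of its inverse, from the second on, lie in [[7/8, 1)],
     where [x_0] and [x_1] coincide. *)
  apply: place_edge => [v i|v i|v|v]; apply: V_eq; rewrite sval_out ?itO ?itI.
  - have /(iter_x0_lt i) : 0 < sval (g v) < 3 / 4 by have := z34 v; lra.
    by move: (iter _ _ _) => y /= y12; affine_cases.
  - rewrite iterS; have /(iter_x0V_ge i) : 1 / 2 <= sval (g v) < 1 by have := z34 v; lra.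
    by move: (iter _ _ _) => y /= y12; affine_cases.
  - rewrite sval_inn /= xc /halve; have := z34 v; rewrite /= => z.
    by affine_cases.
  - by rewrite /= xc /halve; have := z34 v; rewrite /= => z; affine_cases.
apply: (@agree_local (Pgraph w' u0) (schreier (f u0)) n f) => //.
- exact: P_marked.
- by move=> s u v _ _; exact: fe.
- move=> u v /height_near hu /height_near hv /place_inj[|guv]; last first.
    by apply; move/(congr1 sval): guv => /= guv; apply: (@grey_value_inj m w N) => //;
      rewrite -/(x (ptree u)) -/(x (ptree v)); lra.
  move=> v1 v2 [//|k] /(congr1 sval); rewrite itO => v12; exfalso.
  have /(iter_x0_lt k) : 0 < sval (g v1) < 3 / 4 by have := z34 v1; lra.
  by rewrite v12; have := z34 v2; lra.
Qed.

Lemma line_marked i : marked (line_loops i) /\ marked (line_double i).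
Proof.
split; split => s u; rewrite /=.
- case: s; first by exists (u + 1); split => [|v ->].
  by exists u; split => [|v ->].
- case: s; first by exists (u - 1); split => [|v /=]; lia.
  by exists u; split => [|v ->].
- by exists (u + 1); split => [|v ->].
- by exists (u - 1); split => [|v /=]; lia.
Qed.

Section line.
Variables (E : gen -> int -> int -> Prop) (i : int).
Local Notation G := (PtGraph E i).

Lemma line_connected : (forall j, E X0 j (j + 1)) -> connected G.
Proof.
move=> EX; have step (j : G) : conn j (j + 1 : G) by apply: (@conn_edge _ X0); exact: EX.
apply: (@connected_hub G 0) => j.
elim/int_rec: j => [|k IHk|k IHk]; first exact: conn_refl.
  by apply: conn_trans IHk; apply: conn_sym; rewrite -addn1 PoszD; exact: step.
apply: conn_trans IHk; have := step (- k.+1%:Z).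
by rewrite -addn1 PoszD opprD addrNK.
Qed.

Lemma line_near n (u : G) : (forall s (j j' : int), E s j j' -> `|j' - j| <= 1) ->
  near n base u -> `|(u : int) - i| <= n%:Z.
Proof.
move=> E1; elim: n u => [u <-|n IHn u /= [/IHn|]]; [by rewrite subrr|lia|].
by move=> [x /IHn hx [s [/E1|/E1]]]; move: hx; rewrite /=; lia.
Qed.

End line.

Let exp2V_bounds (e : nat) : 0 < (2 ^- e.+1 : R) <= 1 / 2.
Proof.
rewrite invr_gt0 exprn_gt0//= exprS invfM -[leRHS]mulr1 div1r ler_pM2l ?invr_gt0//.
by rewrite invf_le1 ?exprn_gt0// exprn_ege1// ler1n.
Qed.

Let exp2V_inj : injective (fun e => 2 ^- e : R).
Proof.
by move=> e e' /invr_inj; apply: ieexprIn; rewrite ?ltr0n// eq_sym lt_eqF ?ltr1n.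
Qed.

Let exp2VS (e : nat) : 2 ^- e.+1 = 2 ^- e / 2 :> R.
Proof. by rewrite exprS invfM mulrC. Qed.

(** A black ray far away from its grey vertex. *)
Lemma line_loops_approx i n : exists q : V, agree n (line_loops i) (schreier q).
Proof.
pose e (j : int) := absz (n.+2%:Z + (j - i)).
have hf j : orbit_half (2 ^- (e j).+1 : R).
  by apply/orbit_halfP; split; [exact: dyadic2V|have := exp2V_bounds (e j); lra].
pose f (j : line_loops i) : V := exist _ _ (hf j).
have near_i (u : line_loops i) : near n.+1 base u -> `|(u : int) - i| <= n.+1%:Z.
  by apply: line_near => -[] j k /= ->; lia.
exists (f i); apply: (@agree_local _ (schreier (f i)) n f) => //.
- exact: (line_marked i).1.
- exact: schreier_marked.
- move=> s u v /near_i hu _ uv; apply/schreier_edge; have := exp2V_bounds (e u).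
  case: s uv => /= ->; rewrite /x0_map /x1_map => b01; rewrite ifT; try lra.
  have -> : e (u + 1) = (e u).+1 by rewrite /e; lia.
  by rewrite [RHS]exp2VS.
- move=> u v /near_i hu /near_i hv /(congr1 sval) /= /exp2V_inj [].
  by rewrite /e; lia.
Qed.

(** A white ray far away from its grey vertex. *)
Lemma line_double_approx i n : exists q : V, agree n (line_double i) (schreier q).
Proof.
pose e (j : int) := absz (n.+2%:Z + (i - j)).
have hf (j : int) : @orbit_half R (1 - 2 ^- (e j).+2).
  apply/orbit_halfP; split; first by apply: dyadicB; [exact: dyadic1|exact: dyadic2V].
  by have := exp2V_bounds (e j).+1; lra.
pose f (j : line_double i) : V := exist _ _ (hf j).
have near_i (u : line_double i) : near n.+1 base u -> `|(u : int) - i| <= n.+1%:Z.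
  by apply: line_near => s j k /= ->; lia.
exists (f i); apply: (@agree_local _ (schreier (f i)) n f) => //.
- exact: (line_marked i).2.
- exact: schreier_marked.
- move=> s u _ /near_i hu _ ->; apply/schreier_edge.
  have eu : e u = (e (u + 1)).+1 by rewrite /e; lia.
  rewrite /= eu; have := exp2V_bounds (e (u + 1)); rewrite !exp2VS.
  by move: (2 ^- _) => y y01; case: s => /=; affine_cases.
- move=> u v /near_i hu /near_i hv /(congr1 sval) /= /addrI /oppr_inj /exp2V_inj [].
  by rewrite /e; lia.
Qed.

End approximation.

(** * Classification of the limits *)

Section limits.
Variables (R : realType) (G : ptgraph) (mG : marked G) (cG : connected G).
Hypothesis limG : forall n, exists q : {x : R | orbit_half x}, agree n G (schreier q).
Implicit Types (u v r : G) (z : R) (a b : seq (gen * bool)) (p : seq bool) (k n : nat).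

Local Notation actG := (act mG).
Local Notation s0 := (out mG X0).
Local Notation s1 := (out mG X1).
Local Notation i0 := (inn mG X0).
Local Notation i1 := (inn mG X1).

(** Local properties of the Schreier graph are inherited by [G] through this
    lemma: they amount to computations with the two piecewise linear maps. *)
Lemma limit_at v n : exists z, [/\ dyadic z, 0 < z < 1 & forall a b,
  (size a <= n)%N -> (size b <= n)%N ->
  actG a v = actG b v <-> ract a z = ract b z].
Proof.
have [l /(near_act mG)[c ->]] := cG base v.
have [q Gq] := limG (n + size c).
have qP := svalP (act (schreier_marked q) c base).
exists (sval (act (schreier_marked q) c base)).
have [dz z01] := (orbit_halfP _).1 qP; split => // a b an bn.
have sz d : (size d <= n)%N -> (size (d ++ c) <= n + size c)%N.
  by rewrite size_cat leq_add2r.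
rewrite -!(sval_act (q := q)) -!act_cat; split => [ab|/V_eq ab].
  by congr sval; apply: (agree_act (schreier_marked q) Gq) ab; exact: sz.
by apply: (agree_act mG (iso_sym Gq)) ab; exact: sz.
Qed.

(** In the Schreier graph this singles out the points of [(0, 1/2]]: the black
    vertices and the root [1 / 2]. *)
Definition is_black v := s1 v = v.

Lemma x1_fixed z : 0 < z < 1 -> x1_map z = z <-> z <= 1 / 2.
Proof.
rewrite /x1_map => z01; case: leP => [//|?]; split; last lra.
by case: leP => ?; last case: leP => ?; lra.
Qed.

Lemma ract_bounds a z : dyadic z -> 0 < z < 1 -> 0 < ract a z < 1.
Proof.
move=> dz z01; have [] // := (orbit_halfP (ract a z)).1 _.
elim: a => [|[s []] a IHa] /=; first exact/orbit_halfP.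
  exact: smap_orbit.
exact: sinv_orbit.
Qed.

Lemma limit_black v n : exists z, [/\ dyadic z, 0 < z < 1,
  forall a b, (size a <= n)%N -> (size b <= n)%N ->
    actG a v = actG b v <-> ract a z = ract b z &
  forall a, (size a < n)%N -> is_black (actG a v) <-> ract a z <= 1 / 2].
Proof.
have [z [dz z01 zE]] := limit_at v n; exists z; split => // a an.
apply: iff_trans (x1_fixed (ract_bounds a dz z01)).
exact: (zE ((X1, true) :: a) a an (ltnW an)).
Qed.

(** In the Schreier graph the first condition means [r <= 1 / 2], and the second
    one [1 / 2 <= r], because [x_0] and [x_1] coincide exactly on [[7/8, 1)]. *)
Definition rootlike r := is_black r /\ s1 (i0 (i0 r)) = i0 r.

(** The walk from the root of [G] to its base leads from [1 / 2] to the bases of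
    all Schreier graphs that agree with [G] on large balls, so that these graphs
    are all the same. *)
Lemma rootlike_schreier r : rootlike r ->
  exists q : {x : R | orbit_half x}, iso G (schreier q).
Proof.
move=> [rb rr].
have [l /(near_act mG)[d rE]] := cG base r.
have [l' /(near_act mG)[c bE]] := cG r base.
pose N := (size d + size c + 3)%N.
have qE n (q : {x : R | orbit_half x}) : (N <= n)%N -> agree n G (schreier q) ->
    sval q = ract c (1 / 2).
  move=> Nn Gq; set mS := schreier_marked q.
  have tr a b : (size a <= 3)%N -> (size b <= 3)%N -> actG a r = actG b r ->
      ract a (ract d (sval q)) = ract b (ract d (sval q)).
    rewrite rE -!act_cat => a3 b3 ab.
    have /(congr1 sval) : act mS (a ++ d) base = act mS (b ++ d) base.
      by apply: agree_act Gq _ _ ab; rewrite size_cat; move: Nn; rewrite /N; lia.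
    by rewrite !sval_act /ract !foldr_cat.
  have z12 : ract d (sval q) = 1 / 2.
    have [dq q01] := (orbit_halfP _).1 (svalP q).
    have z01 := ract_bounds d dq q01.
    have := tr [:: (X1, true)] [::] isT isT rb.
    have := tr [:: (X1, true); (X0, false); (X0, false)] [:: (X0, false)] isT isT rr.
    move: (ract d _) z01 => z z01; rewrite [ract [::] _]/= => E1 /(x1_fixed z01) z12.
    move: E1; rewrite /ract /rmove /=; affine_cases.
  have /(congr1 sval) : act mS (c ++ d) base = act mS [::] base.
    apply: (agree_act (mG := mG) mS Gq); rewrite ?size_cat //.
      by move: Nn; rewrite /N; lia.
    by rewrite act_cat -rE -bE.
  by rewrite !sval_act /ract foldr_cat -/(ract d _) z12 => <-.
have [q Gq] := limG N; exists q.
apply: agree_iso => //; [exact: schreier_marked|exact: schreier_connected|].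
move=> n; have [q' Gq'] := limG (maxn n N).
have -> : q = q'.
  by apply: V_eq; rewrite (qE _ _ (leqnn N) Gq) (qE _ _ (leq_maxr n N) Gq').
exact: agree_mono (leq_maxl n N) Gq'.
Qed.

Lemma black_out v : is_black v -> is_black (s0 v).
Proof.
have [z [_ z01 _ zb]] := limit_black v 2.
move=> /(zb [::] isT) /= z12; apply/(zb [:: (X0, true)] isT).
by rewrite /ract /rmove /=; affine_cases.
Qed.

(** In the Schreier graph this singles out the points of [(1/2, 3/4]]: the grey
    vertices other than [1 / 2], and also [3 / 4], which is white but adjacent to
    the root. *)
Definition is_grey v := ~ is_black v /\ is_black (s0 v).

Lemma is_grey_out1 v : is_grey v -> is_grey (s1 v).
Proof.
have [z [_ z01 _ zb]] := limit_black v 3.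
have b1 := zb [::] isT; have b2 := zb [:: (X0, true)] isT.
have b3 := zb [:: (X1, true)] isT; have b4 := zb [:: (X0, true); (X1, true)] isT.
move=> [nb /b2]; rewrite /ract /rmove /= in b1 b2 b3 b4 * => x0z.
have zgt : 1 / 2 < z by rewrite ltNge; apply/negP => /b1.
split; first move/b3; last apply/b4; move: x0z; affine_cases.
Qed.

(** In the Schreier graph such a point exceeds [3 / 4]. On [[7/8, 1)] the maps
    [x_0] and [x_1] coincide, and both take [(3/4, 7/8)] into [(1/2, 3/4)]. *)
Lemma white_out1 v : ~ is_black v -> ~ is_black (s0 v) ->
  s1 v = s0 v \/ is_grey (s0 v) /\ is_grey (s1 v).
Proof.
have [z [_ z01 zE zb]] := limit_black v 3.
have b1 := zb [::] isT; have b2 := zb [:: (X0, true)] isT.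
have b3 := zb [:: (X1, true)] isT; have b4 := zb [:: (X0, true); (X1, true)] isT.
have b5 := zb [:: (X0, true); (X0, true)] isT.
have e := zE [:: (X1, true)] [:: (X0, true)] isT isT.
move=> nb nb0; rewrite /ract /rmove /= in b1 b2 b3 b4 b5 e.
have zgt : 1 / 2 < z by rewrite ltNge; apply/negP => /b1.
have {nb0} zgt0 : 1 / 2 < x0_map z by rewrite ltNge; apply/negP => /b2.
have {zgt0} z34 : 3 / 4 < z by move: zgt0; affine_cases.
have [z78|z78] := leP (7 / 8) z.
  by left; apply/e; affine_cases.
right; split; split.
- by move/b2; affine_cases.
- by apply/b5; affine_cases.
- by move/b3; affine_cases.
- by apply/b4; affine_cases.
Qed.

Lemma iter_out_free v k : iter k s0 v = v -> k = 0%N.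
Proof.
have actE (l : gen * bool) : actG (nseq k l) v = iter k (move mG l) v.
  by elim: (k) => //= m ->.
have [z [_ z01 zE]] := limit_at v k.
have := zE (nseq k (X0, true)) [::]; rewrite size_nseq actE => /(_ (leqnn k) isT).
move=> [kv _] /kv {zE actE kv}.
case: k => // m /=.
have : 0 < ract (nseq m (X0, true)) z <= z.
  elim: m => [|m IHm] /=; first by rewrite /ract /=; lra.
  by rewrite /ract /= -/(ract _ _); move: (ract _ _) IHm => y; rewrite /rmove /=; affine_cases.
by move: (ract _ _) => y y01 E; exfalso; move: E; rewrite /rmove /=; affine_cases.
Qed.

Definition grey_child (b : bool) v := if b then s1 (i0 v) else s1 v.

Definition child_word p : seq (gen * bool) := flatten
  [seq (if d then [:: (X1, true); (X0, false)] else [:: (X1, true)]) | d <- p].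

Lemma act_child_word p v : actG (child_word p) v = foldr grey_child v p.
Proof. by elim: p => //= -[] p IHp; rewrite /child_word /= -/(child_word p) IHp. Qed.

(** A closed path of children exists in the Schreier graph as well, with all of
    its nodes in [(1/2, 3/4)]. There the passage to a child doubles the
    denominator of [4 * z - 2], the number with the digits [u] of the label
    [10u]. *)
Lemma grey_child_free v p : ~ rootlike (s0 v) -> is_grey v -> foldr grey_child v p = v ->
  p = [::].
Proof.
move=> nr [nb gb] pv.
have [z [dz z01 zE zb]] := limit_black v (size (child_word p) + 3).
have sz m : (m <= 3)%N -> (m <= size (child_word p) + 3)%N.
  by move=> m3; exact: leq_trans (leq_addl _ _).
have b1 := zb [::] (sz 1%N isT); have b2 := zb [:: (X0, true)] (sz 2%N isT).
rewrite /ract /rmove /= in b1 b2; have {}b2 := b2.1 gb.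
have zgt : 1 / 2 < z by rewrite ltNge; apply/negP => /b1.
have zle : z < 3 / 4.
  have : z <= 3 / 4 by move: b2; affine_cases.
  rewrite le_eqVlt => /predU1P[z34|//]; exfalso; apply: nr; split => //.
  rewrite outK; apply/(zE [:: (X1, true); (X0, false)] [::] (sz 2%N isT) isT).
  by rewrite z34 /ract /rmove /=; affine_cases.
have := zE (child_word p) [::] (leq_addr _ _) isT.
rewrite act_child_word pv => -[/(_ erefl) zp _] {zE zb}.
pose y := 4 * z - 2.
have yz : z = 1 / 2 + y / 4 by rewrite /y; lra.
have y01 : 0 < y < 1 by rewrite /y; lra.
have dy : dyadic y by apply: dyadicB; [apply: dyadicM => //|]; exact: dyadic_nat.
have childE q : ract (child_word q) z = 1 / 2 + foldr (@halve R) y q / 4 /\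
    0 <= foldr (@halve R) y q < 1.
  elim: q => [|d q [IHq q01]] /=; first by rewrite -yz; split => //; lra.
  split; last exact: halve_bounds.
  rewrite /child_word /= -/(child_word q) /ract foldr_cat -/(ract (child_word q) z) IHq.
  move: (foldr _ _ q) q01 => t t01; rewrite /halve.
  by case: d; rewrite /rmove /=; affine_cases.
have [d yd] := dyadic_level dy y01.
have lp : level (size p + d).+1 (foldr (@halve R) y p).
  by elim: (p) => //= b q IHq; exact: halve_level.
have py : foldr (@halve R) y p = y by have [+ _] := childE p; rewrite zp /= {1}yz; lra.
move: lp; rewrite py => /level_uniq/(_ yd)[]; case: (p) => //= b q; lia.
Qed.

Lemma grey_or_white v : ~ is_black v -> is_grey v \/ ~ is_black (s0 v).
Proof. by move=> nb; case: (pselect (is_black (s0 v))) => b0; [left|right]. Qed.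

Definition orbit_line (j : int) : G :=
  match j with Posz n => iter n s0 base | Negz n => iter n.+1 i0 base end.

Lemma orbit_lineS j : orbit_line (j + 1) = s0 (orbit_line j).
Proof.
case: j => n; first by rewrite -PoszD addn1.
case: n => [|n]; first by rewrite /= innK.
have -> : Negz n.+1 + 1 = Negz n by rewrite !NegzE; lia.
by rewrite /= innK.
Qed.

Lemma orbit_line_inj : injective orbit_line.
Proof.
have lineD j n : orbit_line (j + n%:Z) = iter n s0 (orbit_line j).
  by elim: n => [|n IHn]; rewrite ?addr0//= -IHn -orbit_lineS -addn1 PoszD addrA.
have le j j' : j <= j' -> orbit_line j = orbit_line j' -> j = j'.
  move=> jj'; have -> : j' = j + `|j' - j|%N%:Z by lia.
  by rewrite lineD => /esym/iter_out_free ->; rewrite addr0.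
move=> j j' E; case: (leP j j') => [|/ltW] jj'; first exact: le.
by apply/esym/le.
Qed.

(** Grey vertices are the only passages along [x_0] from white to black. Without
    them, all vertices have the colour of the base, and [x_1] does not leave an
    orbit of [x_0]. *)
Lemma limit_line : ~ (exists v, is_grey v) ->
  iso (line_loops 0) G \/ iso (line_double 0) G.
Proof.
move=> ng; have white v : ~ is_black v -> ~ is_black (s0 v).
  by move=> nv bv; apply: ng; exists v.
have white1 v : ~ is_black v -> s1 v = s0 v.
  move=> nv; case: (white_out1 nv (white _ nv)) => // -[gv _].
  by case: ng; exists (s0 v).
have [bb|nb] := pselect (is_black base).
- left; have ab v : is_black v.
    apply: (@conn_closed G is_black) (cG base v) bb => x y.
    move=> [[] [/(edge_out mG)->|/(edge_inn mG)->]] bx.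
    + exact: black_out bx.
    + by apply: contrapT => /white; rewrite innK.
    + by rewrite bx.
    + by rewrite -{1}bx outK.
  apply: (@iso_morphism (line_loops 0) G orbit_line) => //.
  + exact: (line_marked 0).1.
  + exact: line_connected.
  + move=> [] x _ /= ->; apply/(edge_out mG); [exact: orbit_lineS|exact/esym/ab].
  + exact: orbit_line_inj.
- right; have ab v : ~ is_black v.
    apply: (@conn_closed G (fun v => ~ is_black v)) (cG base v) nb => x y.
    move=> [[] [/(edge_out mG)->|/(edge_inn mG)->]] nx.
    + exact: white nx.
    + by move/black_out; rewrite innK.
    + by rewrite white1//; exact: white.
    + by move=> bz; apply: nx; rewrite -(innK mG X1 x) bz.
  apply: (@iso_morphism (line_double 0) G orbit_line) => //.
  + exact: (line_marked 0).2.
  + exact: line_connected.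
  + move=> s x _ /= ->; apply/(edge_out mG).
    by rewrite orbit_lineS; case: s => //; rewrite white1.
  + exact: orbit_line_inj.
Qed.

Section rootless.
Hypothesis rootless : forall r, ~ rootlike r.

(** Otherwise the next vertex along [x_0] would look like the root. *)
Lemma parallel_not_grey v : s1 v = s0 v -> ~ is_grey (s0 v).
Proof.
move=> v10 [_ b0]; apply: (rootless (r := s0 (s0 v))); split => //.
by rewrite !outK.
Qed.

Lemma is_grey_child (b : bool) v : is_grey v -> is_grey (grey_child b v).
Proof.
move=> gv; case: b; last exact: is_grey_out1 gv.
have s0z := innK mG X0 v; rewrite /grey_child; move: (i0 v) s0z => z s0z.
rewrite -s0z in gv; have nz0 := gv.1.
have nz : ~ is_black z by move/black_out.
by case: (white_out1 nz nz0) => [/parallel_not_grey/(_ gv)|[]].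
Qed.

Lemma grey_child_inj (b b' : bool) v v' : is_grey v -> is_grey v' ->
  grey_child b v = grey_child b' v' -> b = b' /\ v = v'.
Proof.
have mix x y : is_grey x -> is_grey y -> i0 x = y -> False.
  by move=> [nx _] [_ +] xy; rewrite -xy innK.
have inj1 := can_inj (outK mG X1).
case: b; case: b' => gv gv' /inj1 // E.
- by split => //; exact: (can_inj (innK mG X0)).
- by case: (mix _ _ gv gv').
- by case: (mix _ _ gv' gv).
Qed.

(** The vertex before [v] on the edge labeled [x_1] is the parent of [v] if [v] is
    a right child, and the white neighbour of the parent if [v] is a left child. *)
Definition limit_letter v : bool := ~~ `[< is_grey (i1 v) >].
Definition limit_parent v : G := if limit_letter v then s0 (i1 v) else i1 v.

Lemma limit_parentP v : is_grey v ->
  is_grey (limit_parent v) /\ grey_child (limit_letter v) (limit_parent v) = v.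
Proof.
rewrite /limit_parent /limit_letter => gv.
case: asboolP => /= gz; first by rewrite innK.
have s1z := innK mG X1 v; move: (i1 v) s1z gz => z s1z gz.
have nz : ~ is_black z.
  by move=> bz; apply: gv.1; rewrite -s1z bz.
have [//|nz0] := grey_or_white nz.
case: (white_out1 nz nz0) => [z10|[gz0 _]].
  by case: (parallel_not_grey z10); rewrite -z10 s1z.
by rewrite outK s1z.
Qed.

Lemma iter_limit_parent v k : is_grey v -> is_grey (iter k limit_parent v).
Proof. by move=> gv; elim: k => //= k /limit_parentP[]. Qed.

(** The letters passed on the way up lead back down. *)
Lemma limit_parent_free v k : is_grey v -> iter k limit_parent v = v -> k = 0%N.
Proof.
move=> gv kv.
have [p sp pv] : exists2 p, size p = k & foldr grey_child (iter k limit_parent v) p = v.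
  elim: (k) => [|m [p sp pv]]; first by exists [::].
  exists (rcons p (limit_letter (iter m limit_parent v))); first by rewrite size_rcons sp.
  rewrite foldr_rcons iterS -[RHS]pv.
  by congr foldr; have [] := limit_parentP (iter_limit_parent m gv).
by move: pv; rewrite kv -sp => /(grey_child_free (@rootless _) gv) ->.
Qed.

Lemma iter_black v k : is_black v -> is_black (iter k s0 v).
Proof. by move=> bv; elim: k => //= k; exact: black_out. Qed.

(** An edge labeled [x_1] leads from a grey vertex to a grey one, stays in its orbit
    of [x_0], or starts next to a grey vertex and ends at one. *)
Lemma grey_orbit u : (exists v, is_grey v) ->
  exists v, is_grey v /\ exists k, u = iter k s0 v \/ u = iter k i0 v.
Proof.
pose P u := exists v, is_grey v /\ exists k, u = iter k s0 v \/ u = iter k i0 v.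
have Pg v : is_grey v -> P v by move=> gv; exists v; split => //; exists 0%N; left.
have Po v : P v -> P (s0 v).
  move=> [g [gg [k [->|->]]]]; exists g; split => //; first by exists k.+1; left.
  by case: k => [|k]; [exists 1%N; left|exists k; right; rewrite /= innK].
have Pi v : P v -> P (i0 v).
  move=> [g [gg [k [->|->]]]]; exists g; split => //; last by exists k.+1; right.
  by case: k => [|k]; [exists 1%N; right|exists k; left; rewrite /= outK].
have Ps1 v : P v -> P (s1 v).
  move=> Pv; have [->//|nv] := pselect (is_black v).
  have [gv|nv0] := grey_or_white nv; first exact/Pg/is_grey_out1.
  by case: (white_out1 nv nv0) => [->|[_ /Pg//]]; exact: Po.
have Pi1 v : P v -> P (i1 v).
  have s1z := innK mG X1 v; move: (i1 v) s1z => z <- {v} Pv.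
  have [bz|nz] := pselect (is_black z); first by rewrite bz in Pv.
  have [/Pg//|nz0] := grey_or_white nz.
  rewrite -(outK mG X0 z); apply: Pi.
  by case: (white_out1 nz nz0) => [<-//|[/Pg]].
move=> [v /Pg Pv]; apply: (conn_closed _ (cG v u) Pv) => x y.
by move=> [[] [/(edge_out mG)->|/(edge_inn mG)->]]; [exact: Po|exact: Pi|exact: Ps1|exact: Pi1].
Qed.

(** Successive parents of a grey vertex give the spine and the letters of [w].
    The resulting map from P(w) is injective because no grey vertex is its own
    ancestor. *)
Lemma limit_P : (exists v, is_grey v) -> exists w n, (1 <= n)%N /\
  (iso (Pgraph w (avert n.-1 (gvert 0))) G \/ iso (Pgraph w (bvert n (gvert 0))) G).
Proof.
move=> /(grey_orbit base)[v [gv baseE]].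
pose w : word := fun i => limit_letter (iter i limit_parent v).
pose sp k := iter k limit_parent v.
have spE k : sp k = grey_child (w k) (sp k.+1).
  by have [] := limit_parentP (iter_limit_parent k gv).
pose g : grey -> G := extend w grey_child sp.
have gg x : is_grey (g x).
  apply: (@extend_ind G _ _ _ is_grey) => [k|b y]; first exact: iter_limit_parent.
  exact: is_grey_child.
have gc (b : bool) x : g (child w b x) = grey_child b (g x) by exact: extend_child.
have fe : forall s x y, pedge w s x y -> edge s (place mG g x) (place mG g y).
  apply: place_edge => [x i|x i|x|x]; [|move: (g x) (gg x) => y gy|by rewrite gc|by rewrite gc].
    by rewrite iterSr; apply: (iter_black i); exact: (gg x).2.
  have nb k : ~ is_black (iter k i0 y).
    elim: k => [|k IHk]; first exact: gy.1.
    by move/black_out; rewrite iterS innK.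
  have s0i k : s0 (iter k.+1 i0 y) = iter k i0 y by rewrite iterS innK.
  rewrite -[RHS]s0i; have nbi := nb i.+1; rewrite -s0i in nbi.
  case: (white_out1 (nb i.+2) nbi) => // -[[_]].
  by rewrite !s0i => /nb.
have sep x x' k : iter k s0 (g x) = g x' -> k = 0%N.
  case: k => // k; rewrite iterSr => gx'; exfalso; apply: (gg x').1.
  by rewrite -gx'; apply: iter_black; exact: (gg x).2.
have gI x x' : g x = g x' -> x = x'.
  apply: (@grey_injective _ w g (height x + height x')); rewrite ?leq_addr ?leq_addl//.
    move=> y y'.
    rewrite -{1}(child_letter_parent w y) -{1}(child_letter_parent w y') !gc.
    exact: grey_child_inj.
  move=> i j _ _.
  have lt k l : (k < l)%N -> g (Spine k) = g (Spine l) -> False.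
    move=> kl; rewrite /g /= /sp => kl'.
    have gk := iter_limit_parent k.+1 gv.
    have := @limit_parent_free _ (l - k) gk; rewrite -iterD.
    have -> : (l - k + k.+1 = l.+1)%N by lia.
    by move=> /(_ (esym kl')); lia.
  by case: (ltngtP i j) => // ij E; [case: (lt _ _ ij E)|case: (lt _ _ ij (esym E))].
have isoP (u : pvert) : place mG g u = base -> iso (Pgraph w u) G.
  move=> ub; apply: (@iso_morphism (Pgraph w u) G (place mG g)) => //.
  - exact: P_marked.
  - exact: P_connected.
  - by move=> x y xy; have [/gI + E] := place_inj sep xy; exact: E.
exists w; case: baseE => -[|k] [kE|kE].
- by exists 1%N; split => //; left; exact: isoP.
- by exists 1%N; split => //; left; exact: isoP.
- by exists k.+1; split => //; right; exact: isoP.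
- by exists k.+2; split => //; left; exact: isoP.
Qed.

End rootless.

End limits.

(** * Labels *)

Section labels.
Implicit Types (w a b u : word) (p q : seq bool) (s : gen) (v : grey).

Lemma wcat_head x p u : wcat (x :: p) u 0%N = x. Proof. by []. Qed.

Lemma wcat_cat p q u : wcat (p ++ q) u = wcat p (wcat q u).
Proof.
elim: p => [|x p IHp]; apply/funext => i; first by rewrite /= /wcat /= subn0.
by case: i => // i; have /(congr1 (fun f => f i)) := IHp.
Qed.

Definition wtail u : word := fun i => u i.+1.

Lemma wtail_cons x p u : wtail (wcat (x :: p) u) = wcat p u.
Proof. by []. Qed.

Lemma wcat_nil u : wcat [::] u = u.
Proof. by apply/funext => i; rewrite /wcat /= subn0. Qed.

Definition step_out s u : word :=
  match s with
  | X0 =>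
    if u 0%N then if wtail u 0%N then wcat [:: true] (wtail (wtail u))
      else wcat [:: false; true] (wtail (wtail u))
    else wcat [:: false; false] (wtail u)
  | X1 =>
    if u 0%N then
      if wtail u 0%N then
        if wtail (wtail u) 0%N then wcat [:: true; true] (wtail (wtail (wtail u)))
        else wcat [:: true; false; true] (wtail (wtail (wtail u)))
      else wcat [:: true; false; false] (wtail (wtail u))
    else u
  end.

Definition step_inn s u : word :=
  match s with
  | X0 =>
    if u 0%N then wcat [:: true; true] (wtail u)
    else if wtail u 0%N then wcat [:: true; false] (wtail (wtail u))
    else wcat [:: false] (wtail (wtail u))
  | X1 =>
    if u 0%N then
      if wtail u 0%N then wcat [:: true; true; true] (wtail (wtail u))
      else if wtail (wtail u) 0%N then wcat [:: true; true; false] (wtail (wtail (wtail u)))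
      else wcat [:: true; false] (wtail (wtail (wtail u)))
    else u
  end.

(** Both generators act on infinite words by bijections, so that the label of a
    vertex determines those of its neighbours. *)
Lemma word_step_det s a b : word_step s a b -> b = step_out s a /\ a = step_inn s b.
Proof.
by case=> u; rewrite /step_out /step_inn !wtail_cons !wcat_head ?wcat_nil.
Qed.

(** The word [u] for which [v] has the label [10u]. *)
Definition suffix w : grey -> word :=
  extend w (fun x u => wcat [:: x] u) (fun k i => w (k + i)%N).

Lemma suffix_child w x v : suffix w (child w x v) = wcat [:: x] (suffix w v).
Proof.
apply: extend_child => k; apply/funext => -[|i]; first by rewrite addn0.
by rewrite /wcat /= subn1 addnS.
Qed.

Definition label w (u : pvert) : word :=
  match u with
  | Grey v => wcat [:: true; false] (suffix w v)
  | White v i => wcat (rcons (nseq i.+2 true) false) (suffix w v)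
  | Black v i => wcat (rcons (nseq i.+1 false) true) (suffix w v)
  end.

Lemma label_labeling w : labeling w (label w).
Proof.
split=> // s u _ /pedgeE ->.
case: s u => -[v|v i|v i] /=; rewrite ?suffix_child.
- exact: x0_10.
- by case: i => [|i]; [have := x0_11 (wcat [:: false] (suffix w v))|
    have := x0_11 (wcat (true :: rcons (nseq i true) false) (suffix w v))];
    rewrite -!wcat_cat.
- by have := x0_0 (wcat (rcons (nseq i false) true) (suffix w v)); rewrite -!wcat_cat.
- by have := x1_10 (suffix w v); rewrite -wcat_cat.
- case: i => [|i] /=; last first.
    by have := x1_111 (wcat (rcons (nseq i true) false) (suffix w v)); rewrite -!wcat_cat.
  by rewrite suffix_child; have := x1_110 (suffix w v); rewrite -!wcat_cat.
- by have := x1_0 (wcat (rcons (nseq i false) true) (suffix w v)); rewrite -!wcat_cat.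
Qed.

Lemma labeling_unique w lab lab' : labeling w lab -> labeling w lab' -> lab = lab'.
Proof.
move=> [l0 lP] [l0' lP']; apply/funext => u; pose G := Pgraph w (Grey (gvert 0)).
have cGu := P_connected (w := w) (u0 := Grey (gvert 0)) (Grey (gvert 0)) u.
have l00 : lab (Grey (gvert 0)) = lab' (Grey (gvert 0)) by rewrite l0 l0'.
refine (@conn_closed G (fun x : pvert => lab x = lab' x) _ _ _ cGu l00).
move=> x y [s [xy|xy]] E.
  have [-> _] := word_step_det (lP _ _ _ xy).
  by have [-> _] := word_step_det (lP' _ _ _ xy); rewrite E.
have [_ ->] := word_step_det (lP _ _ _ xy).
by have [_ ->] := word_step_det (lP' _ _ _ xy); rewrite E.
Qed.

Lemma label_gvert0 w n : (1 <= n)%N ->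
  label w (avert n.-1 (gvert 0)) = wcat (rcons (nseq n true) false) w /\
  label w (bvert n (gvert 0)) = wcat (rcons (nseq n false) true) w.
Proof. by case: n => [//|[|n]]. Qed.

End labels.

(** * The closure of the set of Schreier graphs *)

Lemma closure_schreier (R : realType) (H : ptgraph) : marked H -> connected H ->
  (forall n, exists q : {x : R | orbit_half x}, agree n H (schreier q)) ->
  exists2 x : graph_space R,
    closure [set y : graph_space R |
      [set iso_class (schreier q) | q in @setT {x : R | orbit_half x}] (carrier y)] x &
    carrier x = iso_class H.
Proof.
move=> mH cH appr.
have HP : exists2 G, marked G /\ connected G & iso_class H = iso_class G by exists H.
exists (GraphSpace R HP) => //; apply/closure_agreeP => [q|n].
  by split; [exact: schreier_marked|exact: schreier_connected].
have [q Hq] := appr n; exists q; apply: iso_trans Hq; apply: iso_agree.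
have [_ _ /= cE] := repr_graphP (GraphSpace R HP).
suff : iso_class (repr_graph (GraphSpace R HP)) H by [].
by rewrite -cE; exact: iso_refl.
Qed.

Theorem proposition4p1 (R : realType) :
  let schreier_classes : set (set ptgraph) :=
    [set iso_class (schreier q) | q in @setT {x : R | orbit_half x}] in
  let C : set (graph_space R) := [set x | schreier_classes (carrier x)] in
  [/\ @orbit_half R = dyadic `&` `]0, 1[,
      [set carrier x | x in closure C] =
        schreier_classes
        `|` [set c | exists (w : word) (n : nat), (1 <= n)%N /\
              (c = iso_class (Pgraph w (avert n.-1 (gvert 0))) \/
               c = iso_class (Pgraph w (bvert n (gvert 0))))]
        `|` ([set iso_class (line_loops i) | i in setT]
             `|` [set iso_class (line_double i) | i in setT]) &
      forall w : word, exists lab : pvert -> word,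
        unique (labeling w) lab /\
        forall n : nat, (1 <= n)%N ->
          lab (avert n.-1 (gvert 0)) = wcat (rcons (nseq n true) false) w /\
          lab (bvert n (gvert 0)) = wcat (rcons (nseq n false) true) w].
Proof.
move=> schreier_classes C; split; first exact: orbit_halfE; last first.
  move=> w; exists (label w); split; last by move=> n; exact: label_gvert0.
  by split=> [|lab]; [|apply: labeling_unique]; exact: label_labeling.
have mem H : marked H -> connected H ->
    (forall n, exists q : {x : R | orbit_half x}, agree n H (schreier q)) ->
    [set carrier x | x in closure C] (iso_class H).
  by move=> mH cH /(closure_schreier mH cH)[x Cx xH]; exists x.
apply/seteqP; split => [_ [x Cx <-]|c].
  have [mG cG ->] := repr_graphP x.
  have {Cx}limG : forall n, exists q : {x : R | orbit_half x},
      agree n (repr_graph x) (schreier q).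
    apply/closure_agreeP => // q.
    by split; [exact: schreier_marked|exact: schreier_connected].
  have [[r /(rootlike_schreier cG limG)[q Gq]]|rootless] :=
      pselect (exists r, rootlike mG r).
    by left; left; exists q => //; exact: iso_class_eq (iso_sym Gq).
  have {}rootless r : ~ rootlike mG r by move=> rr; apply: rootless; exists r.
  have [gr|ngr] := pselect (exists v, is_grey mG v).
    have [w [n [n0 wn]]] := limit_P cG limG rootless gr.
    left; right; exists w, n; split => //.
    by case: wn => /iso_class_eq wn; [left|right].
  by right; case: (limit_line cG limG ngr) => /iso_class_eq E; [left|right];
    exists 0.
case=> [[[q _ <-]|[w [n [n0 [->|->]]]]]|[[i _ <-]|[i _ <-]]]; apply: mem.
- exact: schreier_marked.
- exact: schreier_connected.
- by move=> n; exists q; exact: iso_refl.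
- exact: P_marked.
- exact: P_connected.
- by move=> k; exact: P_approx.
- exact: P_marked.
- exact: P_connected.
- by move=> k; exact: P_approx.
- exact: (line_marked i).1.
- exact: line_connected.
- by move=> k; exact: line_loops_approx.
- exact: (line_marked i).2.
- exact: line_connected.
- by move=> k; exact: line_double_approx.
Qed.
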